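(* Let $K,m,n,d$ be positive integers. Let $Q$ be a noncommutative multilinear polynomial of degree $d$ in $m$ variables with coefficients in $M_n(\mathbb{C})$. (1) Let $G_1,\dots,G_m$ be i.i.d. with distribution $\mathcal{V}$ and suppose $\|\mathbb{E}(G_1G_1^* )^K\|\le c_K$ for some $c_K\ge1$. Then $$\mathbb{E}_{G_j\sim\mathcal{V}}\mathrm{Tr}\,|Q\{G_j\}|^{2K}\le(2K-1)^{dK}c_K^{d}\,\big(\mathbb{E}_{G_j\sim\mathcal{V}}\mathrm{Tr}\,|Q\{G_j\}|^2\big)^K.$$ (2) More generally, let $G_1,\dots,G_m$ be i.i.d. with a distribution $\mathcal{G}$ on $M_n(\mathbb{C})$ such that $\mathbb{E}G_1=0$, $\mathbb{E}G_1G_1^*=I$ and $\|\mathbb{E}(G_1G_1^* )^K\|\le c_K$ for some $c_K\ge1$. Then $$\mathbb{E}_{G_j\sim\mathcal{G}}\mathrm{Tr}\,|Q\{G_j\}|^{2K}\le(2K-1)^{2dK}c_K^{d}\,\big(\mathbb{E}_{G_j\sim\mathcal{G}}\mathrm{Tr}\,|Q\{G_j\}|^2\big)^K.$$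
   Context: A noncommutative multilinear polynomial of degree $d$ in $m$ variables is an expression $Q(X_1,\dots,X_m)=\sum_{S\subseteq\{1,\dots,m\}:|S|\le d}\widehat{Q}(S)\prod_{i\in S}X_i$, where $\widehat{Q}(S)\in M_n(\mathbb{C})$, the $X_i$ are noncommuting $n\times n$ matrix variables, and products are taken in increasing order of the index. $Q\{G_j\}$ denotes $Q(G_1,\dots,G_m)$. $|A|=(AA^* )^{1/2}$; $\|A\|$ is the operator norm; $\mathrm{Tr}$ is the unnormalized trace. $G\sim\mathcal{V}$ means $G=\sum_{i=1}^N g_iV_i$, where $g_1,\dots,g_N$ are i.i.d. standard complex Gaussian random variables ($\mathbb{E}g_i=0$, $\mathbb{E}|g_i|^2=1$) and $V_1,\dots,V_N\in M_n(\mathbb{C})$ are fixed matrices with $\sum_{i=1}^NV_iV_i^*=\sum_{i=1}^NV_i^*V_i=I_n$. *)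

(* Defs.v *)
From HB Require Import structures.
From mathcomp Require Import all_boot all_order all_algebra.
From mathcomp Require Import all_classical all_reals all_analysis.
From mathcomp Require Import complex.

Set Implicit Arguments.
Unset Strict Implicit.
Unset Printing Implicit Defensive.
Import Order.TTheory GRing.Theory Num.Theory.
Import numFieldNormedType.Exports.
Local Open Scope classical_set_scope.
Local Open Scope ring_scope.

Section Matrices.
Context {R : realType}.
Local Notation C := R[i].

Definition adjmx m n (A : 'M[C]_(m, n)) : 'M[C]_(n, m) :=
  map_mx Num.conj (A^T).

(* Square root by functional calculus: for a normal matrix,
   A = invmx (spectralmx A) *m diag_mx (spectral_diag A) *m spectralmx A with
   spectralmx A unitary; for a positive semidefinite A this is its unique
   positive semidefinite square root. *)
Definition sqrtmx n (A : 'M[C]_n) : 'M[C]_n :=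
  invmx (spectralmx A) *m diag_mx (map_mx sqrtC (spectral_diag A))
    *m spectralmx A.

Definition absmx n (A : 'M[C]_n) : 'M[C]_n := sqrtmx (A *m adjmx A).

Definition l2norm n (v : 'cV[C]_n) : R :=
  Num.sqrt (\sum_i (complex.Re (v i 0) ^+ 2 + complex.Im (v i 0) ^+ 2)).

Definition opnorm n (A : 'M[C]_n) : R :=
  sup [set l2norm (A *m v) | v in [set v : 'cV[C]_n | l2norm v <= 1]].

(* The index enumeration of 'I_m is increasing, so the (noncommutative) product
   is taken in increasing order of the index.  Only the coefficients Q S with
   #|S| <= d are used. *)
Definition ncpoly_eval (d m n : nat) (Q : {set 'I_m} -> 'M[C]_n)
    (X : 'I_m -> 'M[C]_n) : 'M[C]_n :=
  \sum_(S : {set 'I_m} | (#|S| <= d)%N) Q S *m \prod_(i in S) X i.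

Definition cborel : set (set C) :=
  <<s [set A | exists2 B : set R, measurable B &
         A = (@complex.Re R) @^-1` B \/ A = (@complex.Im R) @^-1` B] >>.

Definition mxborel n : set (set 'M[C]_n) :=
  <<s [set A | exists i j, exists2 B, cborel B &
         A = (fun M : 'M[C]_n => M i j) @^-1` B] >>.

End Matrices.

Section Probability.
Context {R : realType} {dsp : measure_display} {T : measurableType dsp}
  (P : probability T R).
Local Notation C := R[i].
Local Open Scope ereal_scope.

(* In the next three definitions F is the sigma-algebra put on U. *)
Definition random_element (U : Type) (F : set (set U)) (X : T -> U) :=
  forall B, F B -> measurable (X @^-1` B).

(* As [set: U] belongs to F, this gives the product rule for every subfamily. *)
Definition independent_family (U : Type) (F : set (set U)) (I : finType)
    (X : I -> T -> U) :=
  forall B : I -> set U, (forall i, F (B i)) ->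
    P (\bigcap_(i in [set: I]) (X i @^-1` B i)) = \prod_i P (X i @^-1` B i).

Definition iid (U : Type) (F : set (set U)) (I : finType) (X : I -> T -> U) :=
  [/\ forall i, random_element F (X i),
      independent_family F X
    & forall i j B, F B -> P (X i @^-1` B) = P (X j @^-1` B)].

(* Real and imaginary parts are independent N(0, 1/2) variables; the second
   argument of normal_prob is the standard deviation. *)
Definition std_cgaussian (g : T -> C) :=
  random_element (@cborel R) g /\
  forall A B : set R, measurable A -> measurable B ->
    P [set w | A (complex.Re (g w)) /\ B (complex.Im (g w))] =
    normal_prob 0%R (Num.sqrt 2^-1)%R A * normal_prob 0%R (Num.sqrt 2^-1)%R B.

Definition mx_integrable n (X : T -> 'M[C]_n) :=
  forall i j, P.-integrable setT (fun w => (complex.Re (X w i j))%:E) /\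
              P.-integrable setT (fun w => (complex.Im (X w i j))%:E).

Definition Emx n (X : T -> 'M[C]_n) : 'M[C]_n :=
  \matrix_(i, j) Complex (fine 'E_P[fun w => complex.Re (X w i j)])
                         (fine 'E_P[fun w => complex.Im (X w i j)]).

(* E Tr |X|^p; the trace of |X|^p is a nonnegative real number, so that the
   expectation is meaningful in the extended reals. *)
Definition Etr_abs n (p : nat) (X : T -> 'M[C]_n) : \bar R :=
  'E_P[fun w => complex.Re (\tr (absmx (X w) ^+ p))].

End Probability.

(* X ~ V : X has the law of \sum_i g_i V_i for some i.i.d. standard complex
   Gaussian g_i, possibly defined on another probability space. *)
Definition gaussian_mx_law (R : realType) (dsp : measure_display)
    (T : measurableType dsp) (P : probability T R) (n N : nat)
    (V : 'I_N -> 'M[R[i]]_n) (X : T -> 'M[R[i]]_n) :=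
  exists (dsp' : measure_display) (T' : measurableType dsp')
         (P' : probability T' R) (g : 'I_N -> T' -> R[i]),
    [/\ iid P' (@cborel R) g,
        forall i, std_cgaussian P' (g i)
      & forall B, mxborel B ->
          P (X @^-1` B) = P' ((fun w => \sum_i g i w *: V i) @^-1` B)].

(* Main.v *)
Require Import Defs.
From HB Require Import structures.
From mathcomp Require Import all_boot all_order all_algebra.
From mathcomp Require Import all_classical all_reals all_analysis.
From mathcomp Require Import complex.
From mathcomp Require Import measurable_realfun polyrcf ring lra.
Import Order.TTheory GRing.Theory Num.Theory.
Import numFieldNormedType.Exports.
Local Open Scope classical_set_scope.
Local Open Scope ring_scope.

Set Implicit Arguments.
Unset Strict Implicit.
Unset Printing Implicit Defensive.

(* Write |X|_2^2 = Tr X X^*.  Since Tr |X|^(2K) <= |X|_2^(2K), it is enough to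
   bound E |Q|_2^(2K) by (l^d E |Q|_2^2)^K with l = (2K - 1) c^(1/K).  This uses
   only E G = 0, E G G^* = 1 and the bound c, so both parts follow.

   The last variable stands on the right: Q = A + B G with A and B depending on
   the other variables, which are independent of G.  Then E <A, B G> = 0 and
   E |Q|_2^2 = E |A|_2^2 + E |B|_2^2.  Three facts carry the induction:
   - the space L^(2K) is 2-smooth: if E |A|_2^(2K-2) <A, Y> = 0, then
     |A + Y|^2 <= |A|^2 + (2K - 1) |Y|^2 for the norms of L^(2K); one compares
     the polynomial p(t) = E |A + t Y|_2^(2K) with (x + (2K - 1) y t^2)^K, whose
     second derivative dominates p'' as long as it dominates p;
   - by Jensen's inequality for the state B^* B / |B|_2^2,
     |B G|_2^(2K) <= |B|_2^(2K-2) Tr (B^* B (G G^* )^K), so that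
     E |B G|_2^(2K) <= c E |B|_2^(2K);
   - A has degree d and B has degree d - 1. *)

(** * Smoothness of the 2K-th moment *)

(** In the Hilbert-Schmidt norm only random vectors of a real Euclidean space remain, and the right
    side of the theorem already is of this form. The order of the products matters: with G as
    rightmost factor, |B G|_2^2 is the trace of B^* B against G G^*, the matrix that the hypotheses
    control.

    The factor l per degree closes the induction. For the norms of L^(2K), |Q|^2 <= |A|^2 + (2K - 1)
    |B G|^2 <= l^d E |A|_2^2 + (2K - 1) c^(1/K) l^(d-1) E |B|_2^2 = l^d E |Q|_2^2, and l^(dK) = (2K
    - 1)^(dK) c^d.

    Smoothness is proved without differentiating a norm or an integral: p has integrable
    coefficients and is derived formally. Here x and y bound the squared norms of A and Y. The
    comparison starts from a strict inequality at t = 0, so these bounds are enlarged by some e > 0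
    that finally tends to 0.

    For the Gaussian law it remains to see that all moments exist, that the mean is 0 and that G G^*
    has mean 1. This comes down to the first two moments of the real normal law, found by comparing
    explicit densities. *)

Lemma young_expr (R : realDomainType) (k : nat) (a b : R) : 0 <= a -> 0 <= b ->
  k.+1%:R * (a ^+ k * b) <= k%:R * a ^+ k.+1 + b ^+ k.+1.
Proof.
move=> a0 b0; elim: k => [|k IH]; first by rewrite !expr0 !expr1; lra.
have : 0 <= b * (k%:R * a ^+ k.+1 + b ^+ k.+1 - k.+1%:R * (a ^+ k * b))
            + k.+1%:R * (a ^+ k * (a - b) ^+ 2).
  apply: addr_ge0; first by rewrite mulr_ge0 ?subr_ge0.
  by rewrite mulr_ge0 // mulr_ge0 ?sqr_ge0 ?exprn_ge0.
rewrite -[_ <= _ in X in _ -> X]subr_ge0; congr (0 <= _).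
by rewrite -[k.+2%:R]natr1 -![k.+1%:R]natr1 !exprS; ring.
Qed.

Lemma expr_sum_le (R : realDomainType) (k : nat) (a b : R) :
  0 <= a -> 0 <= b -> (a + b) ^+ k <= 2 ^+ k * (a ^+ k + b ^+ k).
Proof.
move=> a0 b0; rewrite mulrDr -!exprMn.
have [ab|/ltW ab] := leP a b.
  apply: (@le_trans _ _ ((2 * b) ^+ k)).
    by rewrite lerXn2r ?nnegrE; lra.
  by rewrite lerDr exprn_ge0 //; lra.
apply: (@le_trans _ _ ((2 * a) ^+ k)).
  by rewrite lerXn2r ?nnegrE; lra.
by rewrite lerDl exprn_ge0 //; lra.
Qed.

(** If [d] were negative at 1, it would have a first root [y] in ]0, 1[. Up to [y] it is
    nonnegative, hence convex, hence nondecreasing because its slope at 0 vanishes; so d(y) >= d(0)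
    > 0, a contradiction. *)
Lemma poly_bootstrap (R : rcfType) (d : {poly R}) :
  0 < d.[0] -> d^`().[0] = 0 ->
  (forall t, 0 <= t <= 1 -> 0 <= d.[t] -> 0 <= d^`()^`().[t]) ->
  0 <= d.[1].
Proof.
move=> d0 d'0 d''; rewrite leNgt; apply/negP => d1.
have root_between z : 0 < z -> d.[z] < 0 -> exists2 r, 0 < r < z & root d r.
  move=> z0 dz; have := @poly_ivtoo _ d 0 z (ltW z0).
  rewrite nmulr_llt0 // => /(_ d0)[r].
  by rewrite in_itv => rz rr; exists r.
have [r0 /andP[r0gt r0lt] rr0] := root_between _ ltr01 d1.
case: (next_rootP d 0 1) => [dE|y _ dy0 y01 nr|c _ _ nr].
- by move: d0; rewrite dE horner0 ltxx.
- have [y0 y1] : 0 < y /\ y < 1 by split; rewrite (itvP y01).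
  have dpos z : z \in `]0, y[ -> 0 <= d.[z].
    rewrite in_itv /= => /andP[z0 zy]; rewrite leNgt; apply/negP => dz.
    have [r /andP[r1 r2] rr] := root_between _ z0 dz.
    have := nr r; rewrite in_itv /= r1 (lt_trans r2 zy) => /(_ isT).
    by rewrite rr.
  have d'pos z : z \in `]0, y[ -> 0 <= d^`().[z].
    rewrite in_itv /= => /andP[z0 zy]; rewrite -d'0.
    apply: (@ler_hornerW _ 0 y) => //; rewrite ?in_itv /= ?lexx ?ltW //.
    move=> t ty; apply: d''; last exact: dpos.
    by move: ty; rewrite in_itv /= => /andP[? ?]; rewrite !ltW // (lt_trans _ y1).
  have : d.[0] <= d.[y].
    by apply: (ler_hornerW d'pos); rewrite ?in_itv /= ?lexx ?ltW.
  by rewrite dy0 leNgt d0.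
- by have := nr r0; rewrite in_itv /= r0gt r0lt rr0 => /(_ isT).
Qed.

Section quadratic.
Context {R : comNzRingType}.
Implicit Types (u v z t : R) (p : {poly R}).

(** With u = |A|^2, v = 2 <A, Y> and z = |Y|^2 this is |A + t Y|^2 as a polynomial in t; with v = 0
    it is the base of the comparison polynomial. *)
Definition quad u v z : {poly R} := u%:P + v *: 'X + z *: 'X^2.

Lemma horner_quad u v z t : (quad u v z).[t] = u + v * t + z * t ^+ 2.
Proof. by rewrite !hornerD hornerC !hornerZ hornerX hornerXn. Qed.

Lemma deriv_quad u v z : (quad u v z)^`() = v%:P + (2 * z) *: 'X.
Proof.
rewrite /quad !derivD derivC !derivZ derivX derivXn add0r alg_polyC /= expr1.
by rewrite -scaler_nat scalerA (mulrC z).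
Qed.

Lemma horner_deriv_quad_exp k u v z t : (quad u v z ^+ k.+1)^`().[t] =
  k.+1%:R * ((v + 2 * z * t) * (quad u v z).[t] ^+ k).
Proof.
have := deriv_quad u v z; move: (quad _ _ _) => p dp.
rewrite deriv_exp hornerMn hornerM horner_exp -mulr_natl dp.
by rewrite hornerD hornerZ hornerX hornerC.
Qed.

Lemma horner_deriv2_quad_exp k u v z t : (quad u v z ^+ k.+1)^`()^`().[t] =
  k.+1%:R * (2 * z * (quad u v z).[t] ^+ k +
    k%:R * ((v + 2 * z * t) ^+ 2 * (quad u v z).[t] ^+ k.-1)).
Proof.
have := deriv_quad u v z; move: (quad _ _ _) => p dp.
rewrite deriv_exp derivMn derivM deriv_exp hornerMn hornerD !hornerM hornerMn.
rewrite hornerM !horner_exp -[LHS]mulr_natl -[_ *+ k]mulr_natl dp.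
rewrite derivD derivC derivZ derivX add0r alg_polyC hornerC hornerD hornerZ.
by rewrite hornerX hornerC; ring.
Qed.
End quadratic.

(** * Expectations of real variables and of random polynomials *)

Section expectation.
Context {R : realType} {dsp : measure_display} {T : measurableType dsp}
  (P : probability T R).
Local Notation Int f := (P.-integrable setT (EFin \o f)).
Local Notation E f := (Rintegral P setT f).

Lemma integrable_dom (f g : T -> R) : measurable_fun setT f -> Int g ->
  (forall w, `|f w| <= g w) -> Int f.
Proof.
move=> mf ig fg; apply: le_integrable ig => //; first exact/measurable_EFinP.
by move=> w _ /=; rewrite lee_fin (le_trans (fg w)) // ler_norm.
Qed.

Lemma integrable_add (f g : T -> R) : Int f -> Int g -> Int (fun w => f w + g w).
Proof. by move=> i1 i2; apply: eq_integrable (integrableD _ i1 i2). Qed.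

Lemma integrable_scale (r : R) (f : T -> R) : Int f -> Int (fun w => r * f w).
Proof. by move=> i1; apply: eq_integrable (integrableZl _ r i1). Qed.

Lemma integrable_cst (r : R) : Int (fun=> r).
Proof. exact: finite_measure_integrable_cst. Qed.

Lemma integrable_bigsum (I : Type) (s : seq I) (f : I -> T -> R) :
  (forall i, Int (f i)) -> Int (fun w => \sum_(i <- s) f i w).
Proof.
move=> fi; elim: s => [|i s IH].
  by under eq_fun do rewrite big_nil; exact: integrable_cst.
by under eq_fun do rewrite big_cons; exact: integrable_add.
Qed.

Lemma Rintegral_bigsum (I : Type) (s : seq I) (f : I -> T -> R) :
  (forall i, Int (f i)) ->
  E (fun w => \sum_(i <- s) f i w) = \sum_(i <- s) E (f i).
Proof.
move=> fi; elim: s => [|i s IH].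
  under eq_Rintegral do rewrite big_nil.
  by rewrite big_nil Rintegral_cst // mul0r.
under eq_Rintegral do rewrite big_cons.
by rewrite RintegralD // ?big_cons ?IH //; exact: integrable_bigsum.
Qed.

Lemma Rintegral_prob_cst (r : R) : E (fun=> r) = r.
Proof. by rewrite Rintegral_cst // [X in fine X]probability_setT mulr1. Qed.

Lemma le_expectation (f g : T -> R) : Int f -> Int g ->
  (forall w, f w <= g w) -> E f <= E g.
Proof. by move=> fi gi fg; apply: le_Rintegral. Qed.

Lemma expr_measurable (f : T -> R) k :
  measurable_fun setT f -> measurable_fun setT (fun w => f w ^+ k).
Proof. by move=> mf; exact: measurable_funX. Qed.

(** The expectation is taken coefficient by coefficient, so that it commutes with the formal
    derivative and no limit is interchanged with an integral. *)
Definition Epoly n (F : T -> {poly R}) := \poly_(i < n) E (fun w => (F w)`_i).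

Lemma horner_Epoly n (F : T -> {poly R}) t : (forall w, size (F w) <= n)%N ->
  (forall i, Int (fun w => (F w)`_i)) ->
  Int (fun w => (F w).[t]) /\ (Epoly n F).[t] = E (fun w => (F w).[t]).
Proof.
move=> sF iF.
have FE w : (F w).[t] = \sum_(i <- index_enum 'I_n) t ^+ i * (F w)`_i.
  by rewrite (horner_coef_wide _ (sF w)); apply: eq_bigr => i _; rewrite mulrC.
have iX (i : 'I_n) : Int (fun w => t ^+ i * (F w)`_i).
  exact: integrable_scale.
split; first by rewrite (funext FE); exact: integrable_bigsum.
rewrite horner_poly (funext FE) Rintegral_bigsum //; apply: eq_bigr => i _.
by rewrite RintegralZl // mulrC.
Qed.

Lemma deriv_Epoly n (F : T -> {poly R}) : (forall w, size (F w) <= n)%N ->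
  (forall i, Int (fun w => (F w)`_i)) ->
  (Epoly n F)^`() = Epoly n (fun w => (F w)^`()).
Proof.
move=> sF iF; apply/polyP => i; rewrite coef_deriv !coef_poly.
under [X in _ = if _ then X else _]eq_Rintegral do rewrite coef_deriv -mulr_natl.
rewrite RintegralZl // mulr_natl.
have [lt1|le1] := ltnP i.+1 n; first by rewrite (ltnW lt1).
(* Now [n <= i.+1]: the derivative is truncated at the same [n], which is harmless since the
   coefficient [i.+1] of [F w] vanishes identically. *)
rewrite mul0rn; case: ifP => // _; rewrite -mulr_natl.
suff -> : (fun w => (F w)`_i.+1) = (fun=> 0) by rewrite Rintegral_prob_cst mulr0.
by apply/funext => w; rewrite nth_default // (leq_trans (sF w)).
Qed.

Lemma integrable_coef_deriv (F : T -> {poly R}) i :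
  (forall i, Int (fun w => (F w)`_i)) -> Int (fun w => (F w)^`()`_i).
Proof.
move=> iF; under eq_fun do rewrite coef_deriv -mulr_natl.
exact: integrable_scale.
Qed.

Section smoothness.
Variables (k : nat) (a s b : T -> R).
Hypotheses (ma : measurable_fun setT a) (ms : measurable_fun setT s)
  (mb : measurable_fun setT b).
Hypotheses (a_ge0 : forall w, 0 <= a w) (b_ge0 : forall w, 0 <= b w)
  (s_le : forall w, s w ^+ 2 <= a w * b w).
Hypotheses (ia : Int (fun w => a w ^+ k.+1)) (ib : Int (fun w => b w ^+ k.+1)).

(** The variables [a], [s], [b] stand for |A|^2, <A, Y> and |Y|^2, so [N w] is |A + t Y|^2. Of the
    vectors only the Cauchy-Schwarz inequality [s_le] is kept. *)
Let N w : {poly R} := quad (a w) (2 * s w) (b w).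

Let NE w t : (N w).[t] = a w + 2 * s w * t + b w * t ^+ 2.
Proof. exact: horner_quad. Qed.

Let N_ge0 w t : 0 <= (N w).[t].
Proof.
rewrite NE; have := a_ge0 w; have := b_ge0 w; have := s_le w.
set x := s w; set y := a w; set z := b w => H z0 y0.
have [y00|/eqP yn0] := eqVneq y 0.
  have -> : x = 0.
    by apply/eqP; rewrite -sqrf_eq0 eq_le sqr_ge0 (le_trans H) ?y00 ?mul0r.
  by rewrite y00 mulr0 mul0r addr0 add0r mulr_ge0 ?sqr_ge0.
have yp : 0 < y by rewrite lt_neqAle y0 eq_sym; apply/andP; split => //; apply/eqP.
rewrite -(pmulr_rge0 _ yp).
have -> : y * (y + 2 * x * t + z * t ^+ 2) =
          (y + x * t) ^+ 2 + (y * z - x ^+ 2) * t ^+ 2 by ring.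
by rewrite addr_ge0 ?sqr_ge0 // mulr_ge0 ?sqr_ge0 // subr_ge0.
Qed.

Let coefN w i : (N w)`_i = (i == 0%N)%:R * a w + (i == 1%N)%:R * (2 * s w)
   + (i == 2)%:R * b w.
Proof.
by rewrite !coefE; case: i => [|[|[|i]]] /=;
  rewrite ?(mulr0, mulr1, mul0r, mul1r, addr0, add0r).
Qed.

Let size_NX w j : (size (N w ^+ j) <= (2 * j).+1)%N.
Proof.
have sN : (size (N w) <= 3)%N.
  by apply/leq_sizeP => i; rewrite coefN; case: i => [|[|[|i]]] //= _;
    rewrite !mul0r !addr0.
apply: leq_trans (size_poly_exp_leq _ _) _.
by rewrite ltnS leq_mul2r; apply/orP; right; rewrite -ltnS; case: (size _) sN.
Qed.

Let measurable_coef_NX j i : measurable_fun setT (fun w => (N w ^+ j)`_i).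
Proof.
elim: j i => [|j IH] i.
  by under eq_fun do rewrite expr0; exact: measurable_cst.
under eq_fun do rewrite exprS coefM.
apply: measurable_sum => l; apply: measurable_funM => //.
under eq_fun do rewrite coefN.
by do !apply: measurable_funD; do !apply: measurable_funM.
Qed.

Let two_s_le w : 2 * `|s w| <= a w + b w.
Proof.
rewrite -(@ler_pXn2r _ 2) ?nnegrE ?mulr_ge0 ?addr_ge0 //.
rewrite exprMn real_normK ?num_real //.
have := s_le w; have := sqr_ge0 (a w - b w).
set x := s w; set y := a w; set z := b w; nra.
Qed.

(** The absolute values of the coefficients of [N w] add up to a + 2|s| + b <= 2 (a + b), and each
    further factor [N w] multiplies the bound by at most this sum. *)
Let coef_NX_le j i w : `|(N w ^+ j)`_i| <= (2 * (a w + b w)) ^+ j.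
Proof.
elim: j i => [|j IH] i.
  by rewrite !expr0 coef1; case: eqP; rewrite ?normr1 ?normr0.
have m0 : 0 <= a w + b w by rewrite addr_ge0.
have M0 l : 0 <= (2 * (a w + b w)) ^+ l by rewrite exprn_ge0 // mulr_ge0.
have -> : N w ^+ j.+1 =
   a w *: N w ^+ j + (2 * s w) *: ('X * N w ^+ j) + b w *: ('X^2 * N w ^+ j).
  by rewrite exprS {1}/N /quad !mulrDl mul_polyC -!scalerAl.
rewrite !coefD !coefZ coefXM coefXnM.
have bnd (c : bool) u : `|if c then 0 else (N w ^+ j)`_u| <= (2 * (a w + b w)) ^+ j.
  by case: c; rewrite ?normr0.
apply: le_trans (ler_normD _ _) _; apply: le_trans (lerD (ler_normD _ _) (lexx _)) _.
rewrite !normrM (ger0_norm (a_ge0 w)) (ger0_norm (b_ge0 w)) normr_nat.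
rewrite exprS; set M := (2 * (a w + b w)) ^+ j.
apply: (@le_trans _ _ (a w * M + 2 * `|s w| * M + b w * M)).
  by rewrite !lerD // ler_wpM2l // ?mulr_ge0 //; exact: bnd.
rewrite -!mulrDl; apply: ler_wpM2r; first exact: M0.
have := two_s_le w; move: (a w) (b w) `|s w| => x y z. lra.
Qed.

Let integrable_coef i : Int (fun w => (N w ^+ k.+1)`_i).
Proof.
have iab : Int (fun w => 4 ^+ k.+1 * (a w ^+ k.+1 + b w ^+ k.+1)).
  exact/integrable_scale/integrable_add.
apply: integrable_dom iab _ => // w; apply: le_trans (coef_NX_le _ _ _) _.
have -> : 4 = 2 * 2 :> R by ring.
rewrite !exprMn -mulrA ler_wpM2l ?exprn_ge0 //.
exact: expr_sum_le.
Qed.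

Let integrable_aks : Int (fun w => a w ^+ k * s w).
Proof.
have iab : Int (fun w => 2 ^+ k.+1 * (a w ^+ k.+1 + b w ^+ k.+1)).
  exact/integrable_scale/integrable_add.
apply: integrable_dom iab _ => [|w].
  by apply: measurable_funM => //; exact: expr_measurable.
apply: le_trans (expr_sum_le _ (a_ge0 w) (b_ge0 w)).
rewrite normrM ger0_norm ?exprn_ge0 // exprSr ler_pM ?exprn_ge0 //.
  by rewrite lerXn2r ?nnegrE ?addr_ge0 // lerDl.
have := two_s_le w; have := normr_ge0 (s w).
by move: (a w) (b w) `|s w| => x y z; lra.
Qed.

(** Let K = k + 1, p(t) = E N(t)^K and q(t) = (x + C t^2)^K with C = (2K - 1) y. Then q(0) > p(0) by
    the strict bound, both derivatives vanish at 0 by orthogonality, and wherever p <= q one has p''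
    <= q''. The bootstrap gives p(1) <= q(1). *)
Lemma expectation_smooth (x y : R) : 0 < x -> 0 < y ->
  E (fun w => a w ^+ k * s w) = 0 ->
  E (fun w => a w ^+ k.+1) < x ^+ k.+1 ->
  E (fun w => b w ^+ k.+1) <= y ^+ k.+1 ->
  Int (fun w => (a w + 2 * s w + b w) ^+ k.+1) /\
  E (fun w => (a w + 2 * s w + b w) ^+ k.+1) <= (x + (2 * k.+1%:R - 1) * y) ^+ k.+1.
Proof.
move=> x0 y0 Eas Ea Eb.
pose n := (2 * k.+1).+1.
pose F w := N w ^+ k.+1.
have sF w : (size (F w) <= n)%N by exact: size_NX.
have sF' w : (size (F w)^`() <= n)%N.
  by apply: leq_trans (sF w); rewrite (leq_trans (size_poly _ _)) // leq_pred.
have sF'' w : (size (F w)^`()^`() <= n)%N.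
  by apply: leq_trans (sF' w); rewrite (leq_trans (size_poly _ _)) // leq_pred.
have iF' i : Int (fun w => (F w)^`()`_i) by exact: integrable_coef_deriv.
have iF'' i : Int (fun w => (F w)^`()^`()`_i) by exact: (integrable_coef_deriv _ iF').
pose p := Epoly n F.
have pE t := horner_Epoly t sF integrable_coef.
have p'E t : p^`().[t] = E (fun w => (F w)^`().[t]).
  by rewrite deriv_Epoly //; exact: (horner_Epoly t sF' iF').2.
have p''E t : p^`()^`().[t] = E (fun w => (F w)^`()^`().[t]).
  rewrite deriv_Epoly // (deriv_Epoly sF' iF').
  exact: (horner_Epoly t sF'' iF'').2.
have kp : 0 <= k%:R :> R by rewrite ler0n.
pose C := (2 * k.+1%:R - 1) * y.
have C0 : 0 < C by rewrite mulr_gt0 // -natr1; lra.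
pose q := quad x 0 C ^+ k.+1.
have qE t : q.[t] = (x + C * t ^+ 2) ^+ k.+1.
  by rewrite horner_exp horner_quad mul0r addr0.
have F'E w t : (F w)^`().[t] = k.+1%:R * ((2 * s w + 2 * b w * t) * (N w).[t] ^+ k).
  exact: horner_deriv_quad_exp.
have F''E w t : (F w)^`()^`().[t] = k.+1%:R * (2 * b w * (N w).[t] ^+ k +
    k%:R * ((2 * s w + 2 * b w * t) ^+ 2 * (N w).[t] ^+ k.-1)).
  exact: horner_deriv2_quad_exp.
have q'' t : 2 * k.+1%:R * C * (x + C * t ^+ 2) ^+ k <= q^`()^`().[t].
  rewrite horner_deriv2_quad_exp horner_quad mul0r addr0 add0r.
  set U := x + _; have U0 : 0 < U.
    by rewrite /U ltr_pwDl // mulr_ge0 ?sqr_ge0 // ltW.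
  rewrite mulrDr -[X in X <= _]addr0 lerD //.
    by rewrite le_eqVlt; apply/orP; left; apply/eqP; ring.
  do 2! apply: mulr_ge0 => //; apply: mulr_ge0; first exact: sqr_ge0.
  by rewrite exprn_ge0 // ltW.
have d1 : 0 <= (q - p).[1].
  apply: poly_bootstrap.
  - rewrite hornerD hornerN qE expr0n mulr0 addr0 subr_gt0 (pE 0).2.
    by under eq_Rintegral do rewrite /F horner_exp NE expr0n !mulr0 !addr0.
  - rewrite derivD derivN hornerD hornerN p'E.
    rewrite horner_deriv_quad_exp mulr0 addr0 mul0r mulr0 add0r.
    under eq_Rintegral => w _.
      rewrite F'E NE expr0n !mulr0 !addr0.
      have -> : k.+1%:R * (2 * s w * a w ^+ k) = (2 * k.+1%:R) * (a w ^+ k * s w) by ring.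
      over.
    by rewrite RintegralZl // Eas mulr0 oppr0.
  - move=> t /andP[t0 t1]; rewrite !(derivB, hornerD, hornerN) !subr_ge0 qE (pE t).2 p''E => pq.
    apply: le_trans (q'' t); set U := x + _ in pq *.
    have U0 : 0 < U by rewrite /U ltr_pwDl // mulr_ge0 ?sqr_ge0 // ltW.
    (* Young's inequality for N/U and b/y takes the place of Hölder's. The function [g] is the
       resulting majorant of the second derivative; by [pq] and the bound on [b] the mean of its
       last factor is at most k + 1. *)
    pose g w := 2 * (2 * k.+1%:R - 1) * (U ^+ k * y) *
       ((k%:R / U ^+ k.+1) * (F w).[t] + (y ^+ k.+1)^-1 * b w ^+ k.+1).
    have ig1 : Int (fun w => k%:R / U ^+ k.+1 * (F w).[t]).
      by apply: integrable_scale; exact: (pE t).1.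
    have ig2 : Int (fun w => (y ^+ k.+1)^-1 * b w ^+ k.+1).
      exact: integrable_scale.
    have yk : 0 < y ^+ k.+1 by rewrite exprn_gt0.
    have Uk : 0 < U ^+ k.+1 by rewrite exprn_gt0.
    have Eg : E g <= 2 * k.+1%:R * C * U ^+ k.
      rewrite /g RintegralZl //; last exact: integrable_add.
      rewrite RintegralD // !RintegralZl //; last exact: (pE t).1.
      have -> : 2 * k.+1%:R * C * U ^+ k = 2 * (2 * k.+1%:R - 1) * (U ^+ k * y) * k.+1%:R.
        by rewrite /C; ring.
      apply: ler_wpM2l.
        by rewrite !mulr_ge0 ?exprn_ge0 // ?ltW // -natr1; lra.
      rewrite -natr1 lerD //.
        by rewrite -mulrA ler_piMr // ler_pdivrMl // mulr1.
      by rewrite ler_pdivrMl // mulr1.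
    apply: le_trans Eg; apply: le_expectation.
    - exact: (horner_Epoly t sF'' iF'').1.
    - exact/integrable_scale/integrable_add.
    move=> w; rewrite F''E /g /F horner_exp.
    have := N_ge0 w t; have := b_ge0 w.
    (* The square is that of the derivative of N, and 4 b N - N'^2 = 4 (a b - s^2) is minus the
       discriminant of N. *)
    have Nb : (2 * s w + 2 * b w * t) ^+ 2 <= 4 * b w * (N w).[t].
      rewrite NE; have := s_le w; set X := s w; set Y := a w; set Z := b w.
      by move=> h; rewrite -subr_ge0; move: h; rewrite -subr_ge0 => h; 
         suff -> : 4 * Z * (Y + 2 * X * t + Z * t ^+ 2) - (2 * X + 2 * Z * t) ^+ 2
           = 4 * (Y * Z - X ^+ 2); [rewrite mulr_ge0|ring].
    set M := (N w).[t] in Nb *; set Z := b w in Nb * => Z0 M0.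
    (* Origin of the constant: the two terms of the second derivative contribute 2 and 4k, and 2 +
       4k = 2 (2K - 1) for K = k + 1. *)
    apply: (@le_trans _ _ (2 * (2 * k.+1%:R - 1) * (k.+1%:R * (M ^+ k * Z)))).
      have h : k%:R * ((2 * s w + 2 * Z * t) ^+ 2 * M ^+ k.-1) <= k%:R * (4 * Z * M ^+ k).
        (* For [k = 0] the predecessor [k.-1] is truncated, but the factor [k] removes the term. *)
        have [->|k0] := posnP k; first by rewrite !mul0r.
        have Mk : M ^+ k = M * M ^+ k.-1 by rewrite -exprS prednK.
        rewrite ler_wpM2l // Mk mulrA.
        by rewrite ler_wpM2r // exprn_ge0.
      have k1 : 0 <= k.+1%:R :> R by [].
      apply: le_trans (ler_wpM2l k1 (lerD (lexx _) h)) _.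
      rewrite le_eqVlt; apply/orP; left; apply/eqP; rewrite -natr1; ring.
    rewrite -[X in _ <= X]mulrA ler_wpM2l //.
    have := young_expr k (divr_ge0 M0 (ltW U0)) (divr_ge0 Z0 (ltW y0)).
    move=> /(ler_wpM2l (ltW (mulr_gt0 (exprn_gt0 k U0) y0))).
    have U1 : U != 0 by rewrite gt_eqF.
    have y1 : y != 0 by rewrite gt_eqF.
    have Uk1 : U ^+ k != 0 by rewrite gt_eqF // exprn_gt0.
    have yk1 : y ^+ k != 0 by rewrite gt_eqF // exprn_gt0.
    rewrite !expr_div_n !exprS.
    have -> : U ^+ k * y * (k.+1%:R * (M ^+ k / U ^+ k * (Z / y))) =
              k.+1%:R * (M ^+ k * Z) by field; rewrite Uk1 y1.
    suff -> : k%:R * (M * M ^+ k / (U * U ^+ k)) + Z * Z ^+ k / (y * y ^+ k) =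
       k%:R / (U * U ^+ k) * (M * M ^+ k) + (y * y ^+ k)^-1 * (Z * Z ^+ k) by [].
    by field; rewrite U1 y1 Uk1 yk1.
have e1 w : (a w + 2 * s w + b w) ^+ k.+1 = (F w).[1].
  by rewrite horner_exp NE expr1n !mulr1.
rewrite (funext e1); split; first exact: (pE 1).1.
move: d1; rewrite hornerD hornerN subr_ge0 (pE 1).2 qE expr1n mulr1.
by [].
Qed.
End smoothness.
End expectation.

(** * Frobenius norm of complex matrices *)

Section finite_sums.
Context {R : realFieldType} {I : finType}.
Implicit Types x y : I -> R.

Lemma sum_cauchy_schwarz x y :
  (\sum_i x i * y i) ^+ 2 <= (\sum_i x i ^+ 2) * (\sum_i y i ^+ 2).
Proof.
set r := \sum_i _; set p := \sum_i x i ^+ 2; set q := \sum_i y i ^+ 2.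
have p0 : 0 <= p by apply: sumr_ge0 => i _; exact: sqr_ge0.
have : 0 <= \sum_i (p * y i - r * x i) ^+ 2.
  by apply: sumr_ge0 => i _; exact: sqr_ge0.
have -> : \sum_i (p * y i - r * x i) ^+ 2 = p * (p * q - r ^+ 2).
  rewrite (eq_bigr (fun i => p ^+ 2 * y i ^+ 2 - 2 * p * r * (x i * y i)
    + r ^+ 2 * x i ^+ 2)); last by move=> i _; ring.
  rewrite big_split /= sumrB -!mulr_sumr -/r -/p -/q; ring.
have [p00 _|pn0] := eqVneq p 0.
  suff -> : r = 0 by rewrite p00 expr0n mul0r.
  apply: big1 => i _; have := p00.
  rewrite /p => /eqP; rewrite psumr_eq0 => [/allP /(_ i)|j _]; last exact: sqr_ge0.
  by rewrite mem_index_enum sqrf_eq0 => /(_ isT) /eqP ->; rewrite mul0r.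
by rewrite pmulr_rge0 ?subr_ge0 // lt_neqAle eq_sym pn0.
Qed.
End finite_sums.

Section log_convex.
Context {R : realFieldType} (u : nat -> R).
Hypotheses (u_ge0 : forall k, 0 <= u k)
  (u_logconvex : forall k, u k.+1 ^+ 2 <= u k * u k.+2).

(** This says that the ratios u(k+1)/u(k) are at least u(1)/u(0); the form without division allows
    terms equal to 0. *)
Let step k : u k * u 1%N <= u 0%N * u k.+1.
Proof.
elim: k => [//|k IH].
have := u_ge0 k; rewrite le_eqVlt => /orP[/eqP uk|uk].
  have := u_logconvex k; rewrite -uk mul0r => h.
  have -> : u k.+1 = 0 by apply/eqP; rewrite -sqrf_eq0 eq_le h sqr_ge0.
  by rewrite mul0r mulr_ge0.
rewrite -(ler_pM2l uk); have := ler_wpM2l (u_ge0 k.+1) IH.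
have := ler_wpM2l (u_ge0 0%N) (u_logconvex k); rewrite expr2.
by move: (u k) (u k.+1) (u k.+2) (u 0%N) (u 1%N) => a b c d e; lra.
Qed.

(** Jensen's inequality for moments: if u(j) is the j-th moment of a positive measure of mass u(0),
    the (k+1)-th power of its mean is at most the mean of the (k+1)-th power. *)
Lemma log_convex_expr k : u 1%N ^+ k.+1 <= u 0%N ^+ k * u k.+1.
Proof.
elim: k => [|k IH]; first by rewrite expr0 mul1r.
rewrite exprSr; apply: le_trans (ler_wpM2r (u_ge0 1%N) IH) _.
rewrite -mulrA exprSr -[leRHS]mulrA ler_wpM2l ?exprn_ge0 //.
Qed.
End log_convex.

Section frobenius.
Context {R : realType}.
Local Notation C := R[i].

(* The real coordinates of a complex matrix: the boolean selects the real or the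
   imaginary part. *)
Definition rcoord m n (c : 'I_m * 'I_n * bool) (X : 'M[C]_(m, n)) : R :=
  if c.2 then complex.Re (X c.1.1 c.1.2) else complex.Im (X c.1.1 c.1.2).

(** The real inner product Re Tr X Y^*. Real coordinates reduce measurability, integrability and
    independence to real random variables. *)
Definition dot m n (X Y : 'M[C]_(m, n)) : R := \sum_c rcoord c X * rcoord c Y.

Definition fro2 m n (X : 'M[C]_(m, n)) : R := \sum_c rcoord c X ^+ 2.

Lemma rcoordD m n c (X Y : 'M[C]_(m, n)) : rcoord c (X + Y) = rcoord c X + rcoord c Y.
Proof. by rewrite /rcoord mxE; case: ifP => _; rewrite raddfD. Qed.

Lemma rcoord0 m n (c : 'I_m * 'I_n * bool) : rcoord c 0 = 0.
Proof. by rewrite /rcoord mxE; case: ifP. Qed.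

Lemma dotC m n (X Y : 'M[C]_(m, n)) : dot X Y = dot Y X.
Proof. by apply: eq_bigr => c _; rewrite mulrC. Qed.

Lemma dotXX m n (X : 'M[C]_(m, n)) : dot X X = fro2 X.
Proof. by apply: eq_bigr. Qed.

Lemma fro2D m n (X Y : 'M[C]_(m, n)) : fro2 (X + Y) = fro2 X + 2 * dot X Y + fro2 Y.
Proof.
rewrite /fro2 /dot mulr_sumr -!big_split; apply: eq_bigr => c _.
by rewrite rcoordD /=; ring.
Qed.

Lemma fro2_ge0 m n (X : 'M[C]_(m, n)) : 0 <= fro2 X.
Proof. by apply: sumr_ge0 => c _; exact: sqr_ge0. Qed.

Lemma fro20 m n : fro2 (0 : 'M[C]_(m, n)) = 0.
Proof. by apply: big1 => c _; rewrite rcoord0 expr0n. Qed.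

Lemma dot_sqr_le m n (X Y : 'M[C]_(m, n)) : dot X Y ^+ 2 <= fro2 X * fro2 Y.
Proof. exact: sum_cauchy_schwarz. Qed.

Lemma rcoord_le m n c (X : 'M[C]_(m, n)) (r : R) : 0 <= r -> fro2 X <= r ^+ 2 ->
  `|rcoord c X| <= r.
Proof.
move=> r0 h; rewrite -(@ler_pXn2r _ 2) ?nnegrE // real_normK ?num_real //.
apply: le_trans h; rewrite /fro2 (bigD1 c) //= lerDl.
by apply: sumr_ge0 => i _; exact: sqr_ge0.
Qed.

Lemma sum_rcoord m n (F : 'I_m * 'I_n * bool -> R) :
  \sum_c F c = \sum_i \sum_j (F (i, j, true) + F (i, j, false)).
Proof.
rewrite (eq_bigr (fun c => F (c.1, c.2))); last by case.
rewrite -(pair_bigA _ (fun p b => F (p, b))) /= [RHS]pair_bigA /=.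
by apply: eq_bigr => -[i j] _; rewrite big_bool.
Qed.

Lemma dot_trE m n (X Y : 'M[C]_(m, n)) : dot X Y = complex.Re (\tr (X *m adjmx Y)).
Proof.
rewrite /dot sum_rcoord /mxtrace raddf_sum; apply: eq_bigr => i _.
rewrite mxE raddf_sum; apply: eq_bigr => j _; rewrite /rcoord !mxE /=.
by case: (X i j) (Y i j) => a b [c d] /=; rewrite mulrN opprK.
Qed.

Lemma adjmxM m n p (X : 'M[C]_(m, n)) (Y : 'M[C]_(n, p)) :
  adjmx (X *m Y) = adjmx Y *m adjmx X.
Proof. by rewrite /adjmx trmx_mul map_mxM. Qed.

Lemma adjmxK m n (X : 'M[C]_(m, n)) : adjmx (adjmx X) = X.
Proof. by apply/matrixP => i j; rewrite !mxE conjCK. Qed.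

Lemma adjmx_gram m n (X : 'M[C]_(m, n)) :
  adjmx (X *m adjmx X) = X *m adjmx X.
Proof. by rewrite adjmxM adjmxK. Qed.

Lemma adjmx1 n : adjmx (1%:M : 'M[C]_n) = 1%:M.
Proof. by rewrite /adjmx trmx1 map_mx1. Qed.

Lemma adjmxX n (X : 'M[C]_n) k : adjmx (X ^+ k) = adjmx X ^+ k.
Proof.
elim: k => [|k IH]; first by rewrite !expr0 adjmx1.
by rewrite exprS exprSr -!mulmxE adjmxM IH.
Qed.

Lemma dot_mull m n p (X : 'M[C]_(m, p)) (Y : 'M[C]_(m, n)) (Z : 'M[C]_(n, p)) :
  dot X (Y *m Z) = dot (adjmx Y *m X) Z.
Proof. by rewrite !dot_trE adjmxM mulmxA mxtrace_mulC mulmxA. Qed.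

Lemma dot_mulr m n p (X : 'M[C]_(m, p)) (Y : 'M[C]_(m, n)) (Z : 'M[C]_(n, p)) :
  dot X (Y *m Z) = dot (X *m adjmx Z) Y.
Proof. by rewrite !dot_trE adjmxM mulmxA. Qed.

Lemma dot_adj m n (X Y : 'M[C]_(m, n)) : dot (adjmx X) (adjmx Y) = dot Y X.
Proof. by rewrite !dot_trE adjmxK mxtrace_mulC. Qed.

Lemma fro2_adj m n (X : 'M[C]_(m, n)) : fro2 (adjmx X) = fro2 X.
Proof. by rewrite -!dotXX dot_adj. Qed.

Definition sqmodc (z : C) : R := complex.Re z ^+ 2 + complex.Im z ^+ 2.

Lemma sqmodcM x y : sqmodc (x * y) = sqmodc x * sqmodc y.
Proof. by case: x y => a b [c d]; rewrite /sqmodc /=; ring. Qed.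

Lemma fro2E m n (X : 'M[C]_(m, n)) : fro2 X = \sum_i \sum_j sqmodc (X i j).
Proof. by rewrite /fro2 sum_rcoord. Qed.

Lemma fro2_rowcol n (x : 'M[C]_(1, n)) (y : 'M[C]_(n, 1)) :
  sqmodc ((x *m y) 0 0) <= fro2 x * fro2 y.
Proof.
have -> : sqmodc ((x *m y) 0 0) = fro2 (x *m y) by rewrite fro2E !big_ord1.
set z := x *m y.
have z0 := fro2_ge0 z.
(* |z|^2 = <z, x y> = <x^* z, y>, and |x^* z|^2 = |x|^2 |z|^2 since z is a scalar *)
have h := dot_sqr_le (adjmx x *m z) y.
have zE : dot (adjmx x *m z) y = fro2 z by rewrite -dot_mull dotXX.
have xz : fro2 (adjmx x *m z) = fro2 x * fro2 z.
  rewrite -(fro2_adj x) !fro2E mulr_suml; apply: eq_bigr => i _.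
  by rewrite !big_ord1 -sqmodcM mxE big_ord1.
rewrite zE xz in h.
move: z0; rewrite le_eqVlt => /orP[/eqP <-|z0].
  by rewrite mulr_ge0 // fro2_ge0.
by rewrite -(ler_pM2r z0) -expr2 (le_trans h) // le_eqVlt mulrAC eqxx.
Qed.

Lemma fro2_row m n (X : 'M[C]_(m, n)) : fro2 X = \sum_i fro2 (row i X).
Proof.
rewrite fro2E; apply: eq_bigr => i _; rewrite fro2E big_ord1.
by apply: eq_bigr => j _; rewrite mxE.
Qed.

Lemma fro2_col m n (X : 'M[C]_(m, n)) : fro2 X = \sum_j fro2 (col j X).
Proof.
rewrite fro2E exchange_big; apply: eq_bigr => j _; rewrite fro2E.
by apply: eq_bigr => i _; rewrite big_ord1 mxE.
Qed.

Lemma fro2M m n p (X : 'M[C]_(m, n)) (Y : 'M[C]_(n, p)) :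
  fro2 (X *m Y) <= fro2 X * fro2 Y.
Proof.
rewrite (fro2_row X) (fro2_col Y) mulr_suml fro2E ler_sum // => i _.
rewrite mulr_sumr ler_sum // => j _.
apply: le_trans (fro2_rowcol _ _); rewrite le_eqVlt; apply/orP; left; apply/eqP.
by congr sqmodc; rewrite !mxE; apply: eq_bigr => k _; rewrite !mxE.
Qed.

Lemma l2normE n (v : 'cV[C]_n) : l2norm v = Num.sqrt (fro2 v).
Proof. by rewrite fro2E /l2norm; congr Num.sqrt; apply: eq_bigr => i _; rewrite big_ord1. Qed.

Lemma rcoord_scale m n c (r : R) (X : 'M[C]_(m, n)) : rcoord c (r%:C%C *: X) = r * rcoord c X.
Proof.
rewrite /rcoord mxE; case: (X _ _) => a b; case: ifP => _ /=.
  by rewrite mul0r subr0.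
by rewrite mul0r addr0.
Qed.

Lemma fro2_scale m n (r : R) (X : 'M[C]_(m, n)) : fro2 (r%:C%C *: X) = r ^+ 2 * fro2 X.
Proof. by rewrite /fro2 mulr_sumr; apply: eq_bigr => c _; rewrite rcoord_scale exprMn. Qed.

Lemma fro2_eq0 m n (X : 'M[C]_(m, n)) : fro2 X = 0 -> X = 0.
Proof.
move=> /eqP; rewrite psumr_eq0 => [/allP h|c _]; last exact: sqr_ge0.
have {}h c : rcoord c X = 0 by apply/eqP; rewrite -sqrf_eq0; apply: h; rewrite mem_index_enum.
apply/matrixP => i j; rewrite mxE; have := h (i, j, true); have := h (i, j, false).
by rewrite /rcoord /=; case: (X i j) => a b /= -> ->.
Qed.

Lemma l2norm_opnorm n (A : 'M[C]_n) (v : 'cV[C]_n) (c : R) : opnorm A <= c ->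
  l2norm (A *m v) <= c * l2norm v.
Proof.
move=> Ac; rewrite !l2normE.
have [/fro2_eq0 ->|v0] := eqVneq (fro2 v) 0.
  by rewrite mulmx0 fro20 sqrtr0 mulr0.
have vp : 0 < fro2 v by rewrite lt_neqAle eq_sym v0 fro2_ge0.
set r := Num.sqrt (fro2 v); have r0 : 0 < r by rewrite sqrtr_gt0.
have rr : r ^+ 2 = fro2 v by rewrite sqr_sqrtr // ltW.
pose w := (r^-1)%:C%C *: v.
have fw : fro2 w = 1 by rewrite fro2_scale exprVn rr mulVf.
suff : l2norm (A *m w) <= opnorm A.
  rewrite l2normE /w -scalemxAr fro2_scale sqrtrM ?sqr_ge0 // sqrtr_sqr.
  rewrite gtr0_norm ?invr_gt0 // ler_pdivrMl // mulrC => /le_trans; apply.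
  by rewrite ler_wpM2r // ltW.
apply: ub_le_sup; last by exists w => //=; rewrite l2normE fw sqrtr1.
(* The supremum defining [opnorm] is an upper bound only if the set is bounded; the Frobenius norm
   of [A] bounds it. *)
exists (Num.sqrt (fro2 A)) => _ [u /= u1 <-]; rewrite l2normE ler_wsqrtr //.
apply: le_trans (fro2M _ _) _; rewrite ler_piMr ?fro2_ge0 //.
move: u1; rewrite l2normE -[X in _ <= X]sqrtr1 ler_sqrt //.
Qed.

(** The left side is the sum of <v, M v> over the columns v of [adjmx B], and each term is at most c
    |v|^2. *)
Lemma dot_opnorm n (B M : 'M[C]_n) (c : R) : opnorm M <= c ->
  dot B (B *m M) <= c * fro2 B.
Proof.
move=> Mc; rewrite dot_mull.
have -> : dot (adjmx B *m B) M = dot (adjmx B) (M *m adjmx B).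
  by rewrite dot_mulr adjmxK.
rewrite -fro2_adj; set W := adjmx B.
have dW : dot W (M *m W) = \sum_j dot (col j W) (M *m col j W).
  rewrite /dot sum_rcoord exchange_big; apply: eq_bigr => j _; rewrite sum_rcoord.
  apply: eq_bigr => i _; rewrite big_ord1 /rcoord /=.
  suff -> : (M *m col j W) i 0 = (M *m W) i j by rewrite !mxE.
  by rewrite !mxE; apply: eq_bigr => k _; rewrite !mxE.
rewrite dW (fro2_col W) mulr_sumr ler_sum // => j _; set v := col j W.
have h := dot_sqr_le v (M *m v).
have := l2norm_opnorm v Mc; rewrite !l2normE => h2.
apply: le_trans (ler_norm _) _.
have -> : c * fro2 v = Num.sqrt (fro2 v) * (c * Num.sqrt (fro2 v)).
  by rewrite mulrCA -expr2 sqr_sqrtr // fro2_ge0.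
apply: (@le_trans _ _ (Num.sqrt (fro2 v) * Num.sqrt (fro2 (M *m v)))).
  by rewrite -sqrtr_sqr -sqrtrM ?fro2_ge0 // ler_wsqrtr.
by rewrite ler_wpM2l // sqrtr_ge0.
Qed.

Lemma dot_gram n (B G : 'M[C]_n) : fro2 (B *m G) = dot (adjmx B *m B) (G *m adjmx G).
Proof. by rewrite -dotXX dot_mulr -mulmxA dotC dot_mull. Qed.

(* The moments tr (B H^k B^* ) of the state B^* B in the positive matrix H = G G^*
   are log-convex. *)
Lemma fro2_moment n (B G : 'M[C]_n) k : fro2 (B *m G) ^+ k.+1 <=
  fro2 B ^+ k * dot (adjmx B *m B) ((G *m adjmx G) ^+ k.+1).
Proof.
pose H := G *m adjmx G.
have HH : adjmx H = H by exact: adjmx_gram.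
pose u j := dot B (B *m H ^+ j).
have uS i j : u (i + j)%N = dot (B *m H ^+ i) (B *m H ^+ j).
  by rewrite [RHS]dotC [RHS]dot_mulr adjmxX HH -mulmxA mulmxE -exprD dotC addnC.
have uG i j : u (i + j).+1 = dot (B *m H ^+ i *m G) (B *m H ^+ j *m G).
  rewrite [RHS]dotC [RHS]dot_mulr -[_ *m G *m adjmx G]mulmxA -/H -[_ *m H]mulmxA.
  by rewrite mulmxE -exprSr dotC -uS addnS addnC.
have := @log_convex_expr _ u; rewrite /u expr1 expr0 mulmx1 dotXX.
have -> : dot B (B *m H) = fro2 (B *m G) by rewrite dot_gram dot_mull.
have -> : dot (adjmx B *m B) ((G *m adjmx G) ^+ k.+1) = dot B (B *m H ^+ k.+1).
  by rewrite [RHS]dot_mull.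
apply=> j.
  (* The parity of the index decides: u(2i) is the squared norm of B H^i, and u(2i+1) that of B H^i
     G. *)
  rewrite -(odd_double_half j) -addnn addnC.
  case: (odd j); rewrite ?addn1 ?addn0 -/(u _).
    by rewrite uG dotXX fro2_ge0.
  by rewrite uS dotXX fro2_ge0.
(* Log-convexity is Cauchy-Schwarz for B H^i and B H^(i+1) when the index is even, and for B H^i G
   and B H^(i+1) G when it is odd. *)
rewrite -/(u _) -/(u _) -/(u _) -(odd_double_half j) -addnn addnC.
case: (odd j); rewrite ?addn1 ?addn0.
  have := uG j./2 j./2; have := uG j./2 (j./2).+1; have := uG (j./2).+1 (j./2).+1.
  by rewrite !addSn !addnS => -> -> ->; rewrite !dotXX; exact: dot_sqr_le.
have := uS j./2 j./2; have := uS j./2 (j./2).+1; have := uS (j./2).+1 (j./2).+1.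
by rewrite !addSn !addnS => -> -> ->; rewrite !dotXX; exact: dot_sqr_le.
Qed.

Lemma fro2X n (X : 'M[C]_n) k : fro2 (X ^+ k.+1) <= fro2 X ^+ k.+1.
Proof.
elim: k => [//|k IH]; rewrite exprS -mulmxE; apply: le_trans (fro2M _ _) _.
by rewrite [leRHS]exprS ler_wpM2l // fro2_ge0.
Qed.

(** With H = X X^*, Cauchy-Schwarz bounds Tr H^(k+1) = <H^k, H> for k > 0, and submultiplicativity
    of the Frobenius norm does the rest, without eigenvalues. The absolute value makes the bound
    serve as a domination for integrability too. *)
Lemma tr_gram_expr_le n (X : 'M[C]_n) k :
  `|complex.Re (\tr ((X *m adjmx X) ^+ k.+1))| <= fro2 X ^+ k.+1.
Proof.
case: k => [|k]; first by rewrite !expr1 -dot_trE dotXX ger0_norm ?fro2_ge0.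
set H := X *m adjmx X; have HH : adjmx H = H by exact: adjmx_gram.
have -> : complex.Re (\tr (H ^+ k.+2)) = dot (H ^+ k.+1) H.
  by rewrite dot_trE HH mulmxE -exprSr.
rewrite -(@ler_pXn2r _ 2) ?nnegrE ?exprn_ge0 ?fro2_ge0 // real_normK ?num_real //.
apply: le_trans (dot_sqr_le _ _) _.
have fH : fro2 H <= fro2 X ^+ 2.
  by apply: le_trans (fro2M _ _) _; rewrite fro2_adj expr2.
apply: le_trans (ler_wpM2r (fro2_ge0 _) (fro2X _ _)) _.
by rewrite -exprSr -exprM mulnC exprM lerXn2r ?nnegrE ?fro2_ge0 ?sqr_ge0.
Qed.

(** All exponents of |X| in the theorem are even, so this identity is all that is used of the
    functional calculus. It follows from unitary diagonalization, as [sqrtC] squares back to its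
    argument. *)
Lemma absmx_sqr n (X : 'M[C]_n) : absmx X *m absmx X = X *m adjmx X.
Proof.
rewrite /absmx /sqrtmx; set A := X *m adjmx X.
have hA : adjmx A = A := adjmx_gram X.
have nA : A \is normalmx by apply/normalmxP; congr (_ *m _).
have uS : spectralmx A \in unitmx by exact/unitarymx_unit/spectral_unitarymx.
set S := spectralmx A; rewrite [RHS](orthomx_spectralP nA) -/S.
rewrite -!mulmxA (mulmxA S) mulmxV // mul1mx; congr (_ *m _).
rewrite !mulmxA mulmx_diag; congr (diag_mx _ *m _).
by apply/rowP => j; rewrite !mxE -expr2 sqrtCK.
Qed.

Lemma absmx_expr n (X : 'M[C]_n) k : absmx X ^+ (2 * k) = (X *m adjmx X) ^+ k.
Proof. by rewrite exprM expr2 -mulmxE absmx_sqr. Qed.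

End frobenius.

(** * Independence and expectations *)

Section independence.
Context {R : realType} {dsp : measure_display} {T : measurableType dsp}
  (P : probability T R).
Local Notation Int f := (P.-integrable setT (EFin \o f)).
Local Notation E f := (Rintegral P setT f).

(** As functions of [A] both sides are finite measures, a restriction of [P] and a multiple of [P].
    They agree on a generating family that is stable under intersection and contains the whole
    space. *)
Lemma indep_extend (F : set (set T)) (B : set T) : F `<=` measurable ->
  setI_closed F -> F setT -> measurable B ->
  (forall A, F A -> P (A `&` B) = (P A * P B)%E) ->
  forall A, <<s F >> A -> P (A `&` B) = (P A * P B)%E.
Proof.
move=> Fm FI FT mB h A sA.
have r0 : 0 <= fine (P B) by rewrite fine_ge0.
have rE : (fine (P B))%:E = P B by rewrite fineK // fin_num_measure.
pose r : {nonneg R} := NngNum r0.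
have cov : \bigcup_(_ : nat) [set: T] = setT.
  by apply/seteqP; split=> // x _; exists 0%N.
have := @g_sigma_algebra_measure_unique _ R T F Fm (fun=> setT) (fun=> FT) cov.
move=> /(_ (mrestr P mB) (mscale r P) FI) /=; rewrite /mrestr /mscale /=.
rewrite rE => u; rewrite [RHS]muleC; apply: u => //.
- by move=> C FC; rewrite h // muleC.
- by move=> _; rewrite setTI ltey_eq fin_num_measure.
Qed.

Definition indep_rv (f h : T -> R) := forall A B : set R,
  measurable A -> measurable B ->
  P (f @^-1` A `&` h @^-1` B) = (P (f @^-1` A) * P (h @^-1` B))%E.

(** Independence identifies the law of the pair with the product of the two laws, by uniqueness of
    the product measure on rectangles. Fubini's theorem for the function x y then gives both
    claims. *)
Lemma indep_rvM (f h : T -> R) : measurable_fun setT f -> measurable_fun setT h ->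
  indep_rv f h -> Int f -> Int h ->
  Int (fun w => f w * h w) /\ E (fun w => f w * h w) = E f * E h.
Proof.
move=> mf mh fh intf inth.
have mZ := measurable_fun_pair mf mh.
pose X : {RV P >-> R} := mfun_Sub (mem_set mf).
pose Y : {RV P >-> R} := mfun_Sub (mem_set mh).
pose Z : {RV P >-> (R * R)%type} := mfun_Sub (mem_set mZ).
have prodE A : measurable A ->
    (distribution P X \x distribution P Y)%E A = distribution P Z A.
  by apply: product_measure_unique => B C mB mC; exact: fh.
pose F (z : R * R) : \bar R := (z.1 * z.2)%:E.
have mF : measurable_fun setT F.
  apply/measurable_EFinP; apply: measurable_funM.
    exact: measurable_fst.
  exact: measurable_snd.
have maF : measurable_fun setT (fun z => `|F z|)%E by exact: measurableT_comp.
have mE : measurable_fun [set: R] (@EFin R) by exact: EFin_measurable.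
have maE : measurable_fun [set: R] (fun x : R => `|x%:E|)%E by exact: measurableT_comp.
have iX : (distribution P X).-integrable setT (EFin : R -> _).
  by apply: integrable_pushforward.
have iY : (distribution P Y).-integrable setT (EFin : R -> _).
  by apply: integrable_pushforward.
have iXY : ((distribution P X) \x (distribution P Y))%E.-integrable setT F.
  apply/integrable12ltyP => //.
  under eq_integral => x _.
    under eq_integral => y _ do rewrite -[F _]/(x%:E * y%:E)%E abseM.
    rewrite ge0_integralZl //.
    over.
  move: iX iY => /integrableP[_ iX] /integrableP[_ iY].
  have yfin : (\int[distribution P Y]_y `|y%:E|)%E \is a fin_num.
    by rewrite ge0_fin_numE // integral_ge0.
  rewrite -(fineK yfin) ge0_integralZr //; last by rewrite lee_fin fine_ge0 // integral_ge0.
  have xfin : (\int[distribution P X]_x `|x%:E|)%E \is a fin_num.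
    by rewrite ge0_fin_numE // integral_ge0.
  by rewrite -(fineK xfin) -EFinM ltry.
have iZ : (distribution P Z).-integrable setT F.
  apply/integrableP; split => //; move/integrableP : iXY => [_].
  by rewrite (eq_measure_integral (distribution P Z)) // => A mA _; exact: prodE.
have iP : Int (fun w => f w * h w).
  apply/integrableP; split; first by apply/measurable_EFinP; exact: measurable_funM.
  move/integrableP : iZ => [_].
  by rewrite ge0_integral_distribution.
split=> //.
have EE : (\int[P]_w (f w * h w)%:E = \int[P]_w (f w)%:E * \int[P]_w (h w)%:E)%E.
  transitivity (\int[distribution P Z]_z F z)%E.
    by rewrite integral_distribution.
  rewrite -(eq_measure_integral _ (fun A mA _ => prodE A mA)).
  rewrite -integral12_prod_meas1 // /fubini_F.
  have fX : (\int[distribution P X]_x x%:E = \int[P]_w (f w)%:E)%E.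
    by rewrite integral_distribution.
  have fY : (\int[distribution P Y]_x x%:E = \int[P]_w (h w)%:E)%E.
    by rewrite integral_distribution.
  have hfin : (\int[P]_w (h w)%:E)%E \is a fin_num by exact: integrable_fin_num.
  under eq_integral => x _.
    under eq_integral => y _ do rewrite -[F _]/(x%:E * y%:E)%E.
    rewrite integralZl // fY -(fineK hfin).
    over.
  by rewrite integralZr // fX fineK.
by rewrite /Rintegral EE fineM //; exact: integrable_fin_num.
Qed.
End independence.

(** * Random matrices *)

(* A copy of the matrix type carrying the point required by [g_sigma_algebraType]. *)
Definition cmx (R : realType) (n : nat) := 'M[R[i]]_n.
HB.instance Definition _ (R : realType) n := Choice.on (cmx R n).
HB.instance Definition _ (R : realType) n := isPointed.Build (cmx R n) 0.

Section measurable_matrices.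
Context {R : realType} {n : nat}.
Local Notation C := R[i].
Local Notation M := 'M[C]_n.

Definition mxmeas d (T : measurableType d) (X : T -> M) :=
  forall c, measurable_fun setT (fun w => rcoord c (X w)).

Definition mxgen : set (set (cmx R n)) := [set A | exists i j, exists2 B, cborel B &
         A = (fun X : 'M[C]_n => X i j) @^-1` B].

Definition mxBorelType := g_sigma_algebraType mxgen.

Lemma mxmeas_id : @mxmeas _ mxBorelType id.
Proof.
move=> [[i j] b] _ Y mY; rewrite setTI; apply: sub_sigma_algebra.
exists i, j; rewrite /rcoord /=; case: b.
  exists (complex.Re (R := R) @^-1` Y) => //.
  by apply: sub_sigma_algebra; exists Y => //; left.
exists (complex.Im (R := R) @^-1` Y) => //.
by apply: sub_sigma_algebra; exists Y => //; right.
Qed.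

Lemma rcoordM m p q (X : 'M[C]_(m, p)) (Y : 'M[C]_(p, q)) i j b :
  rcoord (i, j, b) (X *m Y) = \sum_k
    (rcoord (i, k, b) X * rcoord (k, j, true) Y
      + (-1) ^+ b * (rcoord (i, k, ~~ b) X * rcoord (k, j, false) Y)).
Proof.
rewrite /rcoord /= mxE; case: b => /=; rewrite raddf_sum; apply: eq_bigr => k _.
  by case: (X i k) (Y k j) => x y [z w] /=; rewrite expr1 mulN1r.
by case: (X i k) (Y k j) => x y [z w] /=; rewrite expr0 mul1r addrC.
Qed.

Lemma rcoord_adj m p (X : 'M[C]_(m, p)) i j b :
  rcoord (i, j, b) (adjmx X) = (-1) ^+ (~~ b) * rcoord (j, i, b) X.
Proof.
rewrite /rcoord /= !mxE; case: (X j i) => x y.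
by case: b => /=; rewrite ?expr0 ?expr1 ?mul1r ?mulN1r.
Qed.

Section closure.
Context {d : measure_display} {T : measurableType d}.
Implicit Types X Y : T -> M.

Lemma mxmeas_comp d' (T' : measurableType d') (X : T' -> M) (f : T -> T') :
  measurable_fun setT f -> mxmeas X -> mxmeas (fun w => X (f w)).
Proof. by move=> mf mX c; exact: (measurableT_comp (mX c) mf). Qed.

Lemma mxmeas_cst (A : M) : mxmeas (fun _ : T => A).
Proof. by move=> c; exact: measurable_cst. Qed.

Lemma mxmeasD X Y : mxmeas X -> mxmeas Y -> mxmeas (fun w => X w + Y w).
Proof.
by move=> mX mY c; under eq_fun do rewrite rcoordD; exact: measurable_funD.
Qed.

Lemma mxmeasM X Y : mxmeas X -> mxmeas Y -> mxmeas (fun w => X w *m Y w).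
Proof.
move=> mX mY [[i j] b]; under eq_fun do rewrite rcoordM.
apply: measurable_sum => k; apply: measurable_funD.
  exact: (measurable_funM (mX _) (mY _)).
apply: measurable_funM; first exact: measurable_cst.
exact: (measurable_funM (mX _) (mY _)).
Qed.

Lemma mxmeas_adj X : mxmeas X -> mxmeas (fun w => adjmx (X w)).
Proof.
move=> mX [[i j] b]; under eq_fun do rewrite rcoord_adj.
by apply: measurable_funM => //; exact: measurable_cst.
Qed.

Lemma mxmeasX X k : mxmeas X -> mxmeas (fun w => X w ^+ k).
Proof.
move=> mX; elim: k => [|k IH].
  by under eq_fun do rewrite expr0; exact: mxmeas_cst.
by under eq_fun do rewrite exprS -mulmxE; exact: mxmeasM.
Qed.

Lemma measurable_dot X Y : mxmeas X -> mxmeas Y ->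
  measurable_fun setT (fun w => dot (X w) (Y w)).
Proof.
move=> mX mY; apply: measurable_sum => c.
exact: (measurable_funM (mX _) (mY _)).
Qed.

Lemma measurable_fro2 X : mxmeas X -> measurable_fun setT (fun w => fro2 (X w)).
Proof. by move=> mX; under eq_fun do rewrite -dotXX; exact: measurable_dot. Qed.

Lemma mxmeas_scale (f : T -> R) X : measurable_fun setT f -> mxmeas X ->
  mxmeas (fun w => (f w)%:C%C *: X w).
Proof.
by move=> mf mX c; under eq_fun do rewrite rcoord_scale; exact: measurable_funM.
Qed.
End closure.
End measurable_matrices.
Arguments mxBorelType R n : clear implicits.

Section expectation_matrices.
Context {R : realType} {n : nat} {dsp : measure_display} {T : measurableType dsp}
  (P : probability T R).
Local Notation C := R[i].
Local Notation M := 'M[C]_n.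
Local Notation Int f := (P.-integrable setT (EFin \o f)).
Local Notation E f := (Rintegral P setT f).

Lemma rcoord_Emx (X : T -> M) c : rcoord c (Emx P X) = E (fun w => rcoord c (X w)).
Proof. by rewrite /rcoord mxE /=; case: c.2; rewrite unlock. Qed.

Lemma mx_integrableP (X : T -> M) :
  mx_integrable P X <-> forall c, Int (fun w => rcoord c (X w)).
Proof.
split=> [iX [[i j] b]|iX i j].
  by have [? ?] := iX i j; rewrite /rcoord /=; case: b.
by split; [exact: (iX (i, j, true))|exact: (iX (i, j, false))].
Qed.

Lemma expectation_dot (X : T -> M) (A : M) : mx_integrable P X ->
  Int (fun w => dot (X w) A) /\ E (fun w => dot (X w) A) = dot (Emx P X) A.
Proof.
move=> /mx_integrableP iX; have iXA c : Int (fun w => rcoord c (X w) * rcoord c A).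
  by under eq_fun do rewrite mulrC; exact: integrable_scale.
split; first exact: integrable_bigsum.
rewrite Rintegral_bigsum //; apply: eq_bigr => c _.
by rewrite rcoord_Emx RintegralZr.
Qed.

Lemma mx_integrable_dom (X : T -> M) (r : T -> R) : mxmeas X -> Int r ->
  (forall w, 0 <= r w) -> (forall w, fro2 (X w) <= r w ^+ 2) -> mx_integrable P X.
Proof.
move=> mX ir r0 Xr; apply/mx_integrableP => c.
by apply: integrable_dom ir _ => // w; exact: rcoord_le.
Qed.

(** On a probability space the pointwise bound f <= 1 + f^(k+1) suffices. *)
Lemma integrable_expr (f : T -> R) k : measurable_fun setT f ->
  (forall w, 0 <= f w) -> Int (fun w => f w ^+ k.+1) -> Int f.
Proof.
move=> mf f0 ifk; have := integrable_add (integrable_cst P 1) ifk.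
move=> /integrable_dom; apply => // w; rewrite ger0_norm //.
have [f1|/ltW f1] := leP (f w) 1; first by rewrite (le_trans f1) // lerDl exprn_ge0.
by rewrite ler_wpDl // exprS ler_peMr // exprn_ege1.
Qed.
End expectation_matrices.

Section independent_matrices.
Context {R : realType} {n m : nat} {dsp : measure_display} {T : measurableType dsp}
  (P : probability T R) (G : 'I_m -> T -> 'M[R[i]]_n).
Local Notation C := R[i].
Local Notation M := 'M[C]_n.
Local Notation Int f := (P.-integrable setT (EFin \o f)).
Local Notation E f := (Rintegral P setT f).
Hypothesis iidG : iid P (@mxborel R n) G.
Implicit Types J : pred 'I_m.

Lemma measurable_G i : measurable_fun setT (G i : T -> mxBorelType R n).
Proof. by have [h _ _] := iidG => _ B mB; rewrite setTI; exact: h. Qed.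

(** A generating family, stable under intersection, of the sigma-algebra of the variables [G i] with
    [i] in [J]. All indices occur, with the full set outside [J], so that the product rule of
    [independent_family] applies directly. *)
Definition cylinders J : set (set T) := [set A | exists2 B : 'I_m -> set M,
  (forall i, mxborel (B i)) /\ (forall i, ~~ J i -> B i = setT) &
  A = \bigcap_(i in [set: 'I_m]) (G i @^-1` B i)].

(** The space [T] with the smaller sigma-algebra of these variables: measurability of
    [X : sigmaT J -> M] expresses that [X] depends only on the [G i] with [i] in [J]. *)
Definition sigmaT J := g_sigma_algebraType (cylinders J).

Let mxborelT : mxborel [set: M].
Proof. exact: (@measurableT _ (mxBorelType R n)). Qed.

Let mxborelI (A B : set M) : mxborel A -> mxborel B -> mxborel (A `&` B).
Proof. exact: (@measurableI _ (mxBorelType R n)). Qed.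

Lemma cylinders_measurable J : cylinders J `<=` measurable.
Proof.
move=> _ [B [mB _] ->]; apply: fin_bigcap_measurable => // i _.
by rewrite -[X in measurable X]setTI; exact: measurable_G (mB i).
Qed.

Lemma cylinders_setI J : setI_closed (cylinders J).
Proof.
move=> _ _ [B [mB JB] ->] [B' [mB' JB'] ->].
exists (fun i => B i `&` B' i).
  by split=> i; [exact: mxborelI|move=> Ji; rewrite JB // JB' // setTI].
by rewrite -bigcapI.
Qed.

Lemma cylinders_setT J : cylinders J setT.
Proof.
exists (fun=> setT) => //; apply/esym/seteqP; split => // x _ i _.
Qed.

Lemma cylinders_indep J J' A B : (forall i, ~~ (J i && J' i)) ->
  cylinders J A -> cylinders J' B -> P (A `&` B) = (P A * P B)%E.
Proof.
move=> JJ' [X [mX JX] ->] [Y [mY JY] ->].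
have [_ ind _] := iidG.
rewrite -bigcapI (ind X) // (ind Y) // -big_split /=.
rewrite (ind (fun i => X i `&` Y i)); last by move=> i; exact: mxborelI.
apply: eq_bigr => i _; have := JJ' i; rewrite negb_and => /orP[/JX ->|/JY ->].
  by rewrite setTI preimage_setT probability_setT mul1e.
by rewrite setIT preimage_setT probability_setT mule1.
Qed.

Lemma sigma_measurable J : <<s cylinders J >> `<=` measurable.
Proof.
by apply: smallest_sub; [exact: sigma_algebra_measurable|exact: cylinders_measurable].
Qed.

(** For cylinders, each index has the full set on one of the two sides, so the products multiply.
    The extension to generated sigma-algebras is then made in one argument at a time. *)
Lemma sigma_indep J J' A B : (forall i, ~~ (J i && J' i)) ->
  <<s cylinders J >> A -> <<s cylinders J' >> B -> P (A `&` B) = (P A * P B)%E.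
Proof.
move=> JJ' sA sB.
apply: (indep_extend (@cylinders_measurable J) (@cylinders_setI J) (cylinders_setT J)) sA.
  exact: sigma_measurable sB.
move=> A' cA'; rewrite setIC muleC.
apply: (indep_extend (@cylinders_measurable J') (@cylinders_setI J') (cylinders_setT J')) sB.
  exact: cylinders_measurable cA'.
by move=> B' cB'; rewrite setIC muleC; exact: cylinders_indep cB'.
Qed.

Lemma measurable_sigmaT J (f : T -> R) : measurable_fun setT (f : sigmaT J -> R) ->
  measurable_fun setT f.
Proof.
move=> mf _ Y mY; apply: (@sigma_measurable J).
exact: mf.
Qed.

Lemma mxmeas_sigmaT J (X : T -> M) : mxmeas (X : sigmaT J -> M) -> mxmeas X.
Proof. by move=> mX c; apply: (@measurable_sigmaT J); exact: mX. Qed.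

Lemma mxmeas_sigmaT_sub J J' (X : T -> M) : subpred J J' ->
  mxmeas (X : sigmaT J -> M) -> mxmeas (X : sigmaT J' -> M).
Proof.
move=> JJ' mX c _ Y mY; have := mX c measurableT Y mY.
apply: sub_sigma_algebra2 => _ [B [mB JB] ->]; exists B => //; split=> // i J'i.
by apply: JB; apply: contra J'i => /JJ'.
Qed.

Lemma mxmeas_sigmaT_G J i : J i -> mxmeas (G i : sigmaT J -> M).
Proof.
move=> Ji; apply: (mxmeas_comp _ mxmeas_id : mxmeas (fun w : sigmaT J => id (G i w : mxBorelType R n))).
move=> _ B mB; rewrite setTI; apply: sub_sigma_algebra.
exists (fun j => if j == i then B else setT).
  by split=> j; [case: ifP|case: eqP => // ->; rewrite Ji].
apply/seteqP; split=> [w Bw j _|w /(_ i I)] /=; last by rewrite eqxx.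
by case: eqP => // ->.
Qed.

Lemma indep_dot J J' (X Y : T -> M) : (forall i, ~~ (J i && J' i)) ->
  mxmeas (X : sigmaT J -> M) -> mxmeas (Y : sigmaT J' -> M) ->
  mx_integrable P X -> mx_integrable P Y ->
  Int (fun w => dot (X w) (Y w)) /\
  E (fun w => dot (X w) (Y w)) = dot (Emx P X) (Emx P Y).
Proof.
move=> JJ' mX mY /mx_integrableP iX /mx_integrableP iY.
have H c : Int (fun w => rcoord c (X w) * rcoord c (Y w)) /\
    E (fun w => rcoord c (X w) * rcoord c (Y w)) = E (fun w => rcoord c (X w)) * E (fun w => rcoord c (Y w)).
  apply: indep_rvM => //.
  - exact: mxmeas_sigmaT mX c.
  - exact: mxmeas_sigmaT mY c.
  - move=> A B mA mB; apply: (sigma_indep JJ').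
      by rewrite -[X in _ X]setTI; exact: mX.
    by rewrite -[X in _ X]setTI; exact: mY.
split; first by apply: integrable_bigsum => c; exact: (H c).1.
rewrite Rintegral_bigsum; last by move=> c; exact: (H c).1.
by apply: eq_bigr => c _; rewrite (H c).2 !rcoord_Emx.
Qed.
End independent_matrices.

(** * Hypercontractivity *)

Lemma root_exists (R : realType) (a : R) k : 0 <= a ->
  exists2 r : R, 0 <= r & r ^+ k.+1 = a.
Proof.
move=> a0; exists (a `^ k.+1%:R^-1); first exact: powR_ge0.
by rewrite -powR_mulrn ?powR_ge0 // -powRrM mulVf // powRr1.
Qed.

Lemma ler_expr_addgt0 (R : realType) (a b C : R) k : 0 <= a -> 0 <= b -> 0 < C ->
  (forall e, 0 < e -> a <= (b + C * e) ^+ k.+1) -> a <= b ^+ k.+1.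
Proof.
move=> /(root_exists k)[r r0 <-] b0 C0 h; rewrite lerXn2r ?nnegrE //.
apply/ler_addgt0Pr => e e0; have := h (e / C) (divr_gt0 e0 C0).
by rewrite mulrCA divff ?gt_eqF // mulr1 ler_pXn2r // ?nnegrE // addr_ge0 // ltW.
Qed.

(** * The last factor of an ordered product *)

Section ordered_products.
Context {R : nzRingType} {n m : nat}.
Implicit Types (X : 'I_m -> 'M[R]_n) (S : {set 'I_m}).

(** The factors do not commute, so the index [o] cannot be pulled out of the product at will. Over
    an interval of natural numbers the product can be cut at [o]: before it the two sets agree, and
    from it on only [o] contributes. *)
Lemma prod_ord_last X (o : 'I_m) S : (forall i, i \in S -> (i < o)%N) ->
  \prod_(i in o |: S) X i = (\prod_(i in S) X i) * X o.
Proof.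
move=> So.
pose F j := if insub j is Some i then X i else 1.
pose p S j := if insub j is Some i then i \in S else false.
have E (A : {set 'I_m}) : \prod_(i in A) X i = \prod_(0 <= j < m | p A j) F j.
  rewrite big_mkord; apply: eq_big => [i|i _]; first by rewrite /p valK.
  by rewrite /F valK.
have om := ltn_ord o.
have pS j : (o <= j)%N -> p S j = false.
  move=> oj; rewrite /p; case: insubP => // i _ ij; apply/negP => /So.
  by rewrite ij ltnNge oj.
have pU j : p (o |: S) j = (j == o :> nat) || p S j.
  rewrite /p; case: insubP => [i _ <-|jm]; first by rewrite !inE.
  by rewrite orbF; apply/esym/eqP => jo; rewrite jo om in jm.
have e0 : \prod_(0 <= j < o | p (o |: S) j) F j = \prod_(0 <= j < o | p S j) F j.
  rewrite big_nat_cond [RHS]big_nat_cond; apply: eq_bigl => j; rewrite pU.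
  by case: ltngtP => //; rewrite ?andbF.
have e1 l : (o <= l)%N -> \prod_(l <= j < m | p S j) F j = 1.
  move=> ol; rewrite big_nat_cond big_pred0 // => j.
  by apply/negP => /andP[/andP[lj _]]; rewrite pS // (leq_trans ol).
have e2 : \prod_(o <= j < m | p (o |: S) j) F j = X o.
  rewrite big_ltn_cond // pU eqxx /= {1}/F valK.
  rewrite big_nat_cond (eq_bigl (fun j => (o < j < m)%N && p S j)).
    by rewrite -big_nat_cond e1 ?mulr1.
  by move=> j; rewrite pU; case: ltngtP.
by rewrite !E !(@big_cat_nat _ _ _ o 0 m) //= ?(ltnW om) // e0 e1 // e2 mulr1.
Qed.
End ordered_products.

(** * Induction on the number of variables *)

Section induction.
Context {R : realType} {n m : nat} {dsp : measure_display} {T : measurableType dsp}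
  (P : probability T R) (G : 'I_m -> T -> 'M[R[i]]_n).
Local Notation C := R[i].
Local Notation M := 'M[C]_n.
Local Notation Int f := (P.-integrable setT (EFin \o f)).
Local Notation E f := (Rintegral P setT f).
Hypothesis iidG : iid P (@mxborel R n) G.
Variables (k : nat) (c g : R).
Local Notation gram i := (fun w => G i w *m adjmx (G i w)).
Hypotheses (g1 : 1 <= g) (gc : g ^+ k.+1 = c).
Hypotheses (iG : forall i, mx_integrable P (G i)) (EG : forall i, Emx P (G i) = 0)
  (iGG : forall i, mx_integrable P (gram i)) (EGG : forall i, Emx P (gram i) = 1%:M)
  (iGK : forall i, mx_integrable P (fun w => gram i w ^+ k.+1))
  (EGK : forall i, opnorm (Emx P (fun w => gram i w ^+ k.+1)) <= c).

(* [ncp j d X]: X is a polynomial of degree at most d in the first j variables. *)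
Inductive ncp : nat -> nat -> (T -> M) -> Prop :=
| ncp_cst d A : ncp 0 d (fun=> A)
| ncp_skip j d X : ncp j d X -> ncp j.+1 d X
| ncp_step j (jm : (j < m)%N) d A B : ncp j d.+1 A -> ncp j d B ->
    ncp j.+1 d.+1 (fun w => A w + B w *m G (Ordinal jm) w).

Let lam := (2 * k.+1%:R - 1) * g.
Let c_ge0 : 0 <= c. Proof. by rewrite -gc exprn_ge0 // (le_trans _ g1). Qed.
Let lam1 : 1 <= lam.
Proof.
have k0 : 0 <= k%:R :> R by [].
by rewrite /lam mulr_ege1 // -natr1; lra.
Qed.

Section step.
Variables (j : nat) (jm : (j < m)%N) (A B : T -> M) (d : nat).
Let J : pred 'I_m := fun i => (i < j)%N.
Let J' : pred 'I_m := fun i => i == Ordinal jm.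
Let o := Ordinal jm.
Let JJ' i : ~~ (J i && J' i).
Proof. by apply/negP => /andP[+ /eqP ij]; rewrite /J ij ltnn. Qed.
Hypotheses (mA : mxmeas (A : sigmaT G J -> M)) (mB : mxmeas (B : sigmaT G J -> M)).
Hypotheses (iA : Int (fun w => fro2 (A w) ^+ k.+1))
  (iB : Int (fun w => fro2 (B w) ^+ k.+1)).

Let mG : mxmeas (G o : sigmaT G J' -> M). Proof. by apply: mxmeas_sigmaT_G; rewrite /J'. Qed.
Let mA' := mxmeas_sigmaT iidG mA.
Let mB' := mxmeas_sigmaT iidG mB.
Let mG' := mxmeas_sigmaT iidG mG.
Let mfA := measurable_fro2 mA'.
Let mfB := measurable_fro2 mB'.
Let mBB : mxmeas ((fun w => adjmx (B w) *m B w) : sigmaT G J -> M).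
Proof. by apply: mxmeasM => //; exact: mxmeas_adj. Qed.
Let mBA : mxmeas ((fun w => adjmx (B w) *m A w) : sigmaT G J -> M).
Proof. by apply: mxmeasM => //; exact: mxmeas_adj. Qed.

Let iA1 : Int (fun w => fro2 (A w)).
Proof. by apply: integrable_expr iA => // w; exact: fro2_ge0. Qed.
Let iB1 : Int (fun w => fro2 (B w)).
Proof. by apply: integrable_expr iB => // w; exact: fro2_ge0. Qed.

Let fro2_BB w : fro2 (adjmx (B w) *m B w) <= fro2 (B w) ^+ 2.
Proof. by apply: le_trans (fro2M _ _) _; rewrite fro2_adj expr2. Qed.

Let fro2_BA w : fro2 (adjmx (B w) *m A w) <= (fro2 (A w) + fro2 (B w)) ^+ 2.
Proof.
apply: le_trans (fro2M _ _) _; rewrite fro2_adj.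
have := fro2_ge0 (A w); have := fro2_ge0 (B w).
by move: (fro2 (A w)) (fro2 (B w)) => x y x0 y0; nra.
Qed.

(** The bound [c] concerns the mean of H^K for H = G G^*, not H^K itself. The weight U = |B|_2^(2k)
    B^* B is independent of G, so H^K may be replaced by its mean under the expectation before the
    operator norm is used. *)
Let moment_BG : Int (fun w => fro2 (B w *m G o w) ^+ k.+1) /\
  E (fun w => fro2 (B w *m G o w) ^+ k.+1) <= c * E (fun w => fro2 (B w) ^+ k.+1).
Proof.
pose U w : M := ((fro2 (B w) ^+ k)%:C%C *: (adjmx (B w) *m B w)).
have mU : mxmeas (U : sigmaT G J -> M).
  apply: mxmeas_scale mBB; apply: expr_measurable; exact: measurable_fro2 mB.
have iU : mx_integrable P U.
  apply: (mx_integrable_dom (mxmeas_sigmaT iidG mU) iB) => w.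
    by rewrite exprn_ge0 // fro2_ge0.
  by rewrite fro2_scale [_ ^+ k.+1]exprSr exprMn ler_wpM2l // sqr_ge0.
have mH : mxmeas ((fun w => gram o w ^+ k.+1) : sigmaT G J' -> M).
  by apply: mxmeasX; apply: mxmeasM => //; exact: mxmeas_adj.
have [iUH EUH] := indep_dot iidG JJ' mU mH iU (iGK o).
have dotU w Y : dot (U w) Y = fro2 (B w) ^+ k * dot (adjmx (B w) *m B w) Y.
  by rewrite /dot mulr_sumr; apply: eq_bigr => a _; rewrite rcoord_scale mulrA.
have le1 w : fro2 (B w *m G o w) ^+ k.+1 <= dot (U w) (gram o w ^+ k.+1).
  by rewrite dotU; exact: fro2_moment.
have i1 : Int (fun w => fro2 (B w *m G o w) ^+ k.+1).
  apply: (integrable_dom _ iUH) => [|w].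
    by apply/expr_measurable/measurable_fro2; exact: mxmeasM.
  by rewrite ger0_norm // exprn_ge0 // fro2_ge0.
split=> //; apply: (le_trans (le_expectation i1 iUH le1)).
have [iUM EUM] := expectation_dot (Emx P (fun w => gram o w ^+ k.+1)) iU.
rewrite EUH -EUM -RintegralZl //; apply: le_expectation => //.
  exact: integrable_scale.
move=> w; rewrite dotU exprSr mulrCA ler_wpM2l ?exprn_ge0 ?fro2_ge0 //.
by rewrite -dot_mull; exact: dot_opnorm.
Qed.

(** Since <A, B G> = <B^* A, G>, the integrand pairs the weight U = |A|_2^(2k) B^* A with the
    independent, centred matrix G. The norm of U is at most (|A|_2^2 + |B|_2^2)^(k+1), which is
    integrable. *)
Let Ecross : E (fun w => fro2 (A w) ^+ k * dot (A w) (B w *m G o w)) = 0.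
Proof.
pose U w : M := ((fro2 (A w) ^+ k)%:C%C *: (adjmx (B w) *m A w)).
have mU : mxmeas (U : sigmaT G J -> M).
  apply: mxmeas_scale mBA; apply: expr_measurable; exact: measurable_fro2 mA.
have iAB := integrable_scale (2 ^+ k.+1) (integrable_add iA iB).
have iU : mx_integrable P U.
  apply: (mx_integrable_dom (mxmeas_sigmaT iidG mU) iAB) => w.
    by rewrite mulr_ge0 ?exprn_ge0 // addr_ge0 ?exprn_ge0 ?fro2_ge0.
  have a0 := fro2_ge0 (A w); have b0 := fro2_ge0 (B w).
  have ab0 := addr_ge0 a0 b0.
  apply: (@le_trans _ _ (((fro2 (A w) + fro2 (B w)) ^+ k.+1) ^+ 2)).
    rewrite fro2_scale [_ ^+ k.+1]exprSr exprMn ler_pM ?sqr_ge0 ?fro2_ge0 //.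
    by rewrite !lerXn2r ?nnegrE ?exprn_ge0 // lerDl.
  rewrite lerXn2r ?nnegrE ?exprn_ge0 ?mulr_ge0 ?addr_ge0 ?exprn_ge0 //.
  exact: expr_sum_le.
have [_] := indep_dot iidG JJ' mU mG iU (iG o).
rewrite EG => EU; transitivity (dot (Emx P U) 0).
  rewrite -EU; apply: eq_Rintegral => w _.
  rewrite dot_mull /dot mulr_sumr; apply: eq_bigr => a _.
  by rewrite rcoord_scale mulrA.
by apply: big1 => a _; rewrite rcoord0 mulr0.
Qed.

(** The cross term <B^* A, G> has mean 0, and |B G|_2^2 = <B^* B, G G^*> has the mean of <B^* B, 1>
    = |B|_2^2. *)
Let Efro2 : E (fun w => fro2 (A w + B w *m G o w)) =
  E (fun w => fro2 (A w)) + E (fun w => fro2 (B w)).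
Proof.
have iBA : mx_integrable P (fun w => adjmx (B w) *m A w).
  apply: (mx_integrable_dom (mxmeas_sigmaT iidG mBA) (integrable_add iA1 iB1)) => // w.
  by rewrite addr_ge0 ?fro2_ge0.
have iBB : mx_integrable P (fun w => adjmx (B w) *m B w).
  by apply: (mx_integrable_dom (mxmeas_sigmaT iidG mBB) iB1) => // w; rewrite fro2_ge0.
have mH : mxmeas (gram o : sigmaT G J' -> M) by apply: mxmeasM => //; exact: mxmeas_adj.
have [i1 E1] := indep_dot iidG JJ' mBA mG iBA (iG o).
have [i2 E2] := indep_dot iidG JJ' mBB mH iBB (iGG o).
have [i3 E3] := expectation_dot 1%:M iBB.
under eq_Rintegral do rewrite fro2D dot_mull dot_gram.
rewrite !RintegralD // ?RintegralZl //; last 2 first.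
- exact: integrable_scale.
- by apply: integrable_add => //; exact: integrable_scale.
rewrite E1 EG E2 EGG -E3; congr (_ + _).
  by rewrite [X in _ * X]big1 ?mulr0 ?addr0 // => a _; rewrite rcoord0 mulr0.
by apply: eq_Rintegral => w _; rewrite -dot_mull mulmx1 dotXX.
Qed.

Hypotheses
  (hA : E (fun w => fro2 (A w) ^+ k.+1) <= (lam ^+ d.+1 * E (fun w => fro2 (A w))) ^+ k.+1)
  (hB : E (fun w => fro2 (B w) ^+ k.+1) <= (lam ^+ d * E (fun w => fro2 (B w))) ^+ k.+1).

Lemma hypercontractive_step :
  Int (fun w => fro2 (A w + B w *m G o w) ^+ k.+1) /\
  E (fun w => fro2 (A w + B w *m G o w) ^+ k.+1) <=
    (lam ^+ d.+1 * E (fun w => fro2 (A w + B w *m G o w))) ^+ k.+1.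
Proof.
have [iBG EBG] := moment_BG.
have mBG : mxmeas (fun w => B w *m G o w) by exact: mxmeasM.
have ms : measurable_fun setT (fun w => dot (A w) (B w *m G o w)).
  exact: measurable_dot.
have lam0 : 0 <= lam by rewrite (le_trans _ lam1).
have g0 : 0 <= g by rewrite (le_trans _ g1).
have EA0 : 0 <= E (fun w => fro2 (A w)).
  by apply: Rintegral_ge0 => w _; exact: fro2_ge0.
have EB0 : 0 <= E (fun w => fro2 (B w)).
  by apply: Rintegral_ge0 => w _; exact: fro2_ge0.
have smooth := expectation_smooth mfA ms (measurable_fro2 mBG)
  (fun w => fro2_ge0 (A w)) (fun w => fro2_ge0 (B w *m G o w))
  (fun w => dot_sqr_le (A w) (B w *m G o w)) iA iBG.
(* Adding e to both bounds makes them positive and the first one strict, even if A or B vanishes.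
   The cost is e + (2K - 1) e = 2K e. *)
have {}smooth e : 0 < e ->
    Int (fun w => fro2 (A w + B w *m G o w) ^+ k.+1) /\
    E (fun w => fro2 (A w + B w *m G o w) ^+ k.+1) <=
    (lam ^+ d.+1 * E (fun w => fro2 (A w + B w *m G o w)) + (2 * k.+1%:R) * e) ^+ k.+1.
  move=> e0.
  pose x := lam ^+ d.+1 * E (fun w => fro2 (A w)).
  pose y := g * (lam ^+ d * E (fun w => fro2 (B w))).
  have x0 : 0 <= x by rewrite mulr_ge0 // exprn_ge0.
  have y0 : 0 <= y by rewrite mulr_ge0 // mulr_ge0 // exprn_ge0.
  have xe0 : 0 < x + e by rewrite ltr_wpDl.
  have ye0 : 0 < y + e by rewrite ltr_wpDl.
  have Ax : E (fun w => fro2 (A w) ^+ k.+1) < (x + e) ^+ k.+1.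
    apply: le_lt_trans hA _; rewrite ltrXn2r ?nnegrE ?(ltW xe0) //.
    by rewrite ltrDl.
  have By : E (fun w => fro2 (B w *m G o w) ^+ k.+1) <= (y + e) ^+ k.+1.
    apply: le_trans EBG _; apply: (@le_trans _ _ (y ^+ k.+1)).
      by rewrite exprMn gc ler_wpM2l.
    by rewrite lerXn2r ?nnegrE ?(ltW ye0) // lerDl ltW.
  have [i1 e1] := smooth _ _ xe0 ye0 Ecross Ax By.
  have fE : (fun w => fro2 (A w + B w *m G o w) ^+ k.+1) =
     (fun w => (fro2 (A w) + 2 * dot (A w) (B w *m G o w) +
        fro2 (B w *m G o w)) ^+ k.+1) by apply/funext => w; rewrite fro2D.
  rewrite fE; split=> //; apply: le_trans e1 _.
  rewrite le_eqVlt; apply/orP; left; apply/eqP; congr (_ ^+ _).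
  by rewrite Efro2 /x /y exprS /lam; ring.
split; first exact: (smooth 1 ltr01).1.
apply: (@ler_expr_addgt0 _ _ _ (2 * k.+1%:R)).
- by apply: Rintegral_ge0 => w _; rewrite exprn_ge0 // fro2_ge0.
- rewrite mulr_ge0 ?exprn_ge0 //; apply: Rintegral_ge0 => w _; exact: fro2_ge0.
- by rewrite mulr_gt0.
- by move=> e e0; exact: (smooth e e0).2.
Qed.
End step.

Lemma ncp_hypercontractive j d X : ncp j d X ->
  [/\ mxmeas (X : sigmaT G (fun i => i < j)%N -> M),
      Int (fun w => fro2 (X w) ^+ k.+1) &
      E (fun w => fro2 (X w) ^+ k.+1) <= (lam ^+ d * E (fun w => fro2 (X w))) ^+ k.+1].
Proof.
elim=> {j d X} [d A|j d X _ [mX iX EX]|j jm d A B _ [mA iA EA] _ [mB iB EB]].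
- split; [exact: mxmeas_cst|exact: integrable_cst|].
  have lam0 : 0 <= lam by rewrite (le_trans _ lam1).
  rewrite !Rintegral_prob_cst; apply: lerXn2r.
  + by rewrite nnegrE fro2_ge0.
  + by rewrite nnegrE mulr_ge0 ?exprn_ge0 ?fro2_ge0.
  + by rewrite ler_peMl ?fro2_ge0 // exprn_ege1.
- split=> //; apply: mxmeas_sigmaT_sub mX => i; exact: ltnW.
- have [i1 E1] := hypercontractive_step jm mA mB iA iB EA EB.
  split=> //; apply: mxmeasD; first by apply: mxmeas_sigmaT_sub mA => i; exact: ltnW.
  apply: mxmeasM; first by apply: mxmeas_sigmaT_sub mB => i; exact: ltnW.
  by apply: mxmeas_sigmaT_G => /=.
Qed.

Lemma ncp_const j d A : ncp j d (fun=> A).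
Proof. by elim: j => [|j IH]; constructor. Qed.

(** The hypothesis on [Q] says that only the first [j] variables occur. The sets that contain the
    last of them give the factor B, of degree one less; the others give A. *)
Lemma ncpoly_eval_ncp j d (Q : {set 'I_m} -> M) : (j <= m)%N ->
  (forall (S : {set 'I_m}) (i : 'I_m), i \in S -> (j <= i)%N -> Q S = 0) ->
  ncp j d (fun w => ncpoly_eval d Q (fun i => G i w)).
Proof.
elim: j d Q => [|j IH] d Q jm Q0.
  have -> : (fun w => ncpoly_eval d Q (fun i => G i w)) =
            (fun=> ncpoly_eval d Q (fun=> 0)).
    apply/funext => w; apply: eq_bigr => S _.
    have [->|[i iS]] := set_0Vmem S; first by rewrite !big_set0.
    by rewrite (Q0 S i) ?mul0mx.
  exact: ncp_const.
(* In degree 0 there is nothing to lower: only the empty set contributes, and the value is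
   constant. *)
case: d => [|d].
  have -> : (fun w => ncpoly_eval 0 Q (fun i => G i w)) =
            (fun=> ncpoly_eval 0 Q (fun=> 0)).
    apply/funext => w; apply: eq_bigr => S.
    by rewrite leqn0 cards_eq0 => /eqP ->; rewrite !big_set0.
  exact: ncp_const.
pose o := Ordinal jm.
pose Q0' (S : {set 'I_m}) := if o \in S then 0 else Q S.
pose Q1' (S : {set 'I_m}) := if o \in S then 0 else Q (o |: S).
have -> : (fun w => ncpoly_eval d.+1 Q (fun i => G i w)) =
   (fun w => ncpoly_eval d.+1 Q0' (fun i => G i w) +
             ncpoly_eval d Q1' (fun i => G i w) *m G o w).
  apply/funext => w; rewrite /ncpoly_eval (bigID (fun S : {set 'I_m} => o \in S)) /=.
  rewrite addrC; congr (_ + _).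
    rewrite [RHS](bigID (fun S : {set 'I_m} => o \in S)) /= [X in _ = X + _]big1 ?add0r; last first.
      by move=> S /andP[_ oS]; rewrite /Q0' oS mul0mx.
    by apply: eq_bigr => S /andP[_ oS]; rewrite /Q0' (negbTE oS).
  rewrite [in RHS](bigID (fun S : {set 'I_m} => o \in S)) /=.
  rewrite [X in _ = (X + _) *m _]big1 ?add0r; last first.
    by move=> S /andP[_ oS]; rewrite /Q1' oS mul0mx.
  (* Sets containing [o] correspond to sets without it, by adding and removing [o]; the cardinality
     bound drops by one. *)
  rewrite mulmx_suml (reindex_onto (fun S => o |: S) (fun S => S :\ o)) /=; last first.
    by move=> S /andP[_ oS]; rewrite finset.setD1K.
  apply: eq_big => [S|S /andP[/andP[_ _] /eqP SE]].
    rewrite finset.setU11 andbT; have [oS|oS] := boolP (o \in S).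
      rewrite andbF; apply/negbTE; rewrite negb_and; apply/orP; right.
      by apply/eqP => SE; have := oS; rewrite -SE !inE eqxx.
    by rewrite finset.setU1K // eqxx andbT cardsU1 oS ltnS andbT.
  have oS : o \notin S by rewrite -SE !inE eqxx.
  rewrite /Q1' (negbTE oS).
  (* Either all indices of the set are at most [j], and then [o] is the last and its factor stands
     on the right, or some index is larger and the coefficient vanishes. *)
  have [/forall_inP sS|] := boolP [forall i in o |: S, (i < j.+1)%N].
    rewrite prod_ord_last ?mulmxA // => i iS.
    have := sS i; rewrite !inE iS orbT => /(_ isT); rewrite ltnS leq_eqVlt.
    case/orP => // /eqP ij; move: oS; have -> : o = i by exact/val_inj.
    by rewrite iS.
  rewrite negb_forall_in => /exists_inP[i iS]; rewrite -leqNgt => ji.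
  by rewrite (Q0 _ i) // !mul0mx.
have gt_j (S : {set 'I_m}) (i : 'I_m) : o \notin S -> i \in S -> (j <= i)%N -> (j < i)%N.
  move=> oS iS; rewrite leq_eqVlt => /orP[/eqP ij|//].
  by move: oS; rewrite (_ : o = i) ?iS //; exact: val_inj.
apply: ncp_step; apply: (IH _ _ (ltnW jm)) => S i iS ji; rewrite /Q0' /Q1'.
  by case: ifPn => // oS; apply: (Q0 S i) => //; exact: gt_j iS ji.
case: ifPn => // oS; apply: (Q0 _ i); first by rewrite !inE iS orbT.
exact: gt_j iS ji.
Qed.

Lemma fro2_hypercontractive d (Q : {set 'I_m} -> M) :
  let F w := fro2 (ncpoly_eval d Q (fun i => G i w)) in
  [/\ mxmeas (fun w => ncpoly_eval d Q (fun i => G i w)), Int (fun w => F w ^+ k.+1) &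
    E (fun w => F w ^+ k.+1) <= (lam ^+ d * E F) ^+ k.+1].
Proof.
move=> F; have Qm (S : {set 'I_m}) (i : 'I_m) : i \in S -> (m <= i)%N -> Q S = 0.
  by rewrite leqNgt ltn_ord.
have [mX iX EX] := ncp_hypercontractive (ncpoly_eval_ncp d (leqnn m) Qm).
by split=> //; exact: (mxmeas_sigmaT iidG mX).
Qed.
End induction.

(** * Moments of the normal law *)

Section same_law.
Context {R : realType} {d d' du : measure_display} {T : measurableType d}
  {T' : measurableType d'} {U : measurableType du}
  (P : probability T R) (P' : probability T' R).
Variables (X : T -> U) (Y : T' -> U).
Hypotheses (mX : measurable_fun setT X) (mY : measurable_fun setT Y)
  (XY : forall B, measurable B -> P (X @^-1` B) = P' (Y @^-1` B)).

(** The two variables live on different spaces, but both expectations are integrals against the same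
    image measure. This carries Gaussian moments from the model to the given matrix. *)
Lemma same_law_expectation (f : U -> R) : measurable_fun setT f ->
  P'.-integrable setT (EFin \o (f \o Y)) ->
  P.-integrable setT (EFin \o (f \o X)) /\
  Rintegral P setT (f \o X) = Rintegral P' setT (f \o Y).
Proof.
move=> mf iY.
pose X' : {RV P >-> U} := mfun_Sub (mem_set mX).
pose Y' : {RV P' >-> U} := mfun_Sub (mem_set mY).
have mEf : measurable_fun setT (EFin \o f) by exact/measurable_EFinP.
have eqI (h : U -> \bar R) :
    (\int[distribution P X']_y h y = \int[distribution P' Y']_y h y)%E.
  by apply: eq_measure_integral => A mA _; exact: XY.
have iX : P.-integrable setT (EFin \o (f \o X)).
  apply/integrableP; split; first by apply/measurable_EFinP; exact: measurableT_comp.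
  rewrite -(@ge0_integral_distribution _ _ _ _ _ P X' (fun y => `|(f y)%:E|%E)) //; last first.
    exact: measurableT_comp.
  rewrite eqI ge0_integral_distribution //; last exact: measurableT_comp.
  by move/integrableP : iY => [].
split=> //; congr fine.
transitivity (\int[distribution P X']_y (EFin \o f) y)%E.
  by rewrite integral_distribution.
by rewrite eqI integral_distribution.
Qed.
End same_law.

Section normal_moments.
Context {R : realType} (s : R).
Hypothesis s_gt0 : 0 < s.
Local Notation mu := (@lebesgue_measure R).
Local Notation nu := (normal_prob (0 : R) s).
Local Notation Int f := (nu.-integrable setT (EFin \o f)).
Local Notation E f := (Rintegral nu setT f).

Let s_neq0 : s != 0. Proof. by rewrite gt_eqF. Qed.

(** The change of variables is stated with the Radon-Nikodym derivative; it equals the explicit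
    density almost everywhere because both have the same integral on every measurable set. *)
Lemma ge0_integral_normal_prob (f : R -> \bar R) : measurable_fun setT f ->
  (forall x, 0 <= f x)%E ->
  (\int[nu]_x f x = \int[mu]_x (f x * (normal_pdf 0 s x)%:E))%E.
Proof.
move=> mf f0; have dom := @normal_prob_dominates R 0 s.
rewrite -(Radon_Nikodym_SigmaFinite.change_of_variables dom) //.
have iRN := Radon_Nikodym_SigmaFinite.f_integrable dom.
have mpdf : measurable_fun setT (fun x => (normal_pdf 0 s x)%:E).
  by apply/measurable_EFinP; exact: measurable_normal_pdf.
apply: ae_eq_integral => //.
- by apply: emeasurable_funM => //; exact: (measurable_int _ iRN).
- exact: emeasurable_funM.
apply: ae_eqe_mul2l; apply: integral_ae_eq => // A _ mA.
by rewrite -Radon_Nikodym_SigmaFinite.f_integral.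
Qed.

(* [h] is the density of N(m, r) with respect to N(0, s), up to the factor [q]. *)
Let normal_change_density (h : R -> R) (m r q : R) : measurable_fun setT h -> (forall x, 0 <= h x) ->
  (forall x, h x * normal_pdf 0 s x = q * normal_pdf m r x) -> 0 <= q ->
  Int h /\ E h = q.
Proof.
move=> mh h0 hE q0.
have IE : (\int[nu]_x (h x)%:E = q%:E)%E.
  rewrite ge0_integral_normal_prob //; last by apply/measurable_EFinP.
  under eq_integral do rewrite -EFinM hE EFinM.
  rewrite ge0_integralZl //.
  - by rewrite integral_normal_pdf mule1.
  - by apply/measurable_EFinP; exact: measurable_normal_pdf.
  - by move=> x _; rewrite lee_fin normal_pdf_ge0.
split; last by rewrite /Rintegral IE.
apply/integrableP; split; first exact/measurable_EFinP.
under eq_integral => x _ do rewrite /= ger0_norm //.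
by rewrite IE ltry.
Qed.

(** Completing the square: e^(a x) times the density of N(0, s) is a multiple of the density of N(a
    s^2, s), where s is the standard deviation. *)
Lemma normal_expR (a : R) :
  Int (fun x => expR (a * x)) /\ E (fun x => expR (a * x)) = expR (a ^+ 2 * s ^+ 2 / 2).
Proof.
apply: (@normal_change_density _ (a * s ^+ 2) s).
- apply: measurableT_comp => //; apply: measurable_funM => //; exact: measurable_cst.
- by move=> x; exact: expR_ge0.
- move=> x; rewrite !normal_pdfE // /normal_fun mulrCA -expRD [RHS]mulrCA -expRD.
  congr (_ * expR _); rewrite -[s ^+ 2 *+ 2]mulr_natl; field.
  by rewrite s_neq0.
- exact: expR_ge0.
Qed.

(** The function [h] turns the density of N(0, s) into [r] times that of N(0, r s). Values of [r]
    near 1 reveal the second moment. *)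
Lemma normal_expR_sqr (r : R) : 0 < r ->
  let h x := expR (- (x ^+ 2 / (2 * s ^+ 2) * (r ^- 2 - 1))) in Int h /\ E h = r.
Proof.
move=> r0 h; apply: (@normal_change_density _ 0 (r * s)); last exact: ltW.
- apply: measurableT_comp => //; apply: measurableT_comp => //.
  apply: measurable_funM; last exact: measurable_cst.
  by apply: measurable_funM; [exact: measurable_funX|exact: measurable_cst].
- by move=> x; exact: expR_ge0.
- move=> x; rewrite !normal_pdfE ?mulf_neq0 ?gt_eqF // /normal_fun /normal_peak.
  have -> : Num.sqrt ((r * s) ^+ 2 * pi *+ 2) = r * Num.sqrt (s ^+ 2 * pi *+ 2).
    rewrite exprMn -mulrA -mulrnAr sqrtrM ?sqr_ge0 // sqrtr_sqr gtr0_norm //.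
  rewrite invfM !mulrA mulfV ?gt_eqF // mul1r mulrAC -expRD mulrC.
  congr (_ * expR _); rewrite -[s ^+ 2 *+ 2]mulr_natl -[(r * s) ^+ 2 *+ 2]mulr_natl; field.
  by rewrite s_neq0 gt_eqF.
Qed.

(** For k > 0 the exponential series gives |x|^k / k! <= e^|x| <= e^x + e^(-x), which is integrable;
    the summand 1 serves k = 0. *)
Lemma normal_integrable_expr k : Int (fun x => x ^+ k).
Proof.
have [i1 _] := normal_expR 1; have [i2 _] := normal_expR (-1).
have := integrable_scale k`!%:R (integrable_add (integrable_add i1 i2) (integrable_cst nu 1)).
move=> /integrable_dom; apply => [|x].
  by apply: measurable_funX; exact: measurable_id.
rewrite normrX mulN1r mul1r; have e1 := expR_ge0 x; have e2 := expR_ge0 (- x).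
case: k => [|k]; first by rewrite expr0 mul1r; lra.
have := @expR_ge1Dxn R `|x| k (normr_ge0 _).
have fk : 0 < k.+1`!%:R :> R by rewrite ltr0n fact_gt0.
rewrite -lerBrDl ler_pdivrMr // => /le_trans; apply; rewrite mulrC ler_pM2l //.
by case: ger0P => _; move: (expR x) (expR (- x)) e1 e2 => a b; lra.
Qed.

(** Taking means in 1 + a x <= e^(a x) gives 1 + a M <= e^(a^2 s^2 / 2) for every real [a]. The left
    side is linear in [a] and the right side exceeds 1 only quadratically, so M = 0. *)
Lemma normal_mean : E (fun x => x) = 0.
Proof.
have i1 : Int (fun x => x) by have := normal_integrable_expr 1.
set M := E _.
have key a : 1 + a * M <= expR (a ^+ 2 * s ^+ 2 / 2).
  have [ie <-] := normal_expR a.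
  have -> : 1 + a * M = E (fun x => 1 + a * x).
    rewrite RintegralD //; [|exact: integrable_cst|exact: integrable_scale].
    by rewrite Rintegral_prob_cst RintegralZl.
  apply: le_expectation => // [|x]; last exact: expR_ge1Dx.
  by apply: integrable_add; [exact: integrable_cst|exact: integrable_scale].
(* exp (y / 2) <= 1 / (1 - y / 2) turns this into a M (1 - y / 2) <= y / 2. *)
have key2 a : a ^+ 2 * s ^+ 2 <= 1 -> a * M <= a ^+ 2 * s ^+ 2.
  move=> a1; have := key a; set y := a ^+ 2 * s ^+ 2 in a1 *.
  have y0 : 0 <= y by rewrite mulr_ge0 // sqr_ge0.
  have := expR_ge1Dx (- (y / 2)); have := expRxMexpNx_1 (y / 2).
  have := expR_gt0 (y / 2).
  move: (expR (y / 2)) (expR (- (y / 2))) (a * M) => e f z; nra.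
(* [D] is large enough for a = M / D to satisfy a^2 s^2 <= 1. The bound [key2] becomes M^2 D <= M^2
   s^2, and D > s^2 forces M = 0. *)
pose D := 2 * (1 + s ^+ 2) * (1 + M ^+ 2).
have s2 := sqr_ge0 s; have M2 := sqr_ge0 M.
have sD : s ^+ 2 <= D - 1 by rewrite /D; nra.
have MD : M ^+ 2 <= D - 1 by rewrite /D; nra.
have D0 : 0 < D by lra.
have D2 : 0 < D ^+ 2 by rewrite exprn_gt0.
have Dn0 : D != 0 by rewrite gt_eqF.
have e1 : (M / D) ^+ 2 * s ^+ 2 = M ^+ 2 * s ^+ 2 / D ^+ 2 by field.
have e2 : M / D * M = M ^+ 2 / D by field.
have := key2 (M / D); rewrite e1 e2 ler_pdivrMr // mul1r => h.
have {}h : M ^+ 2 / D <= M ^+ 2 * s ^+ 2 / D ^+ 2.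
  by apply: h; rewrite [leRHS]expr2; apply: ler_pM => //; lra.
have {}h : M ^+ 2 * D <= M ^+ 2 * s ^+ 2.
  have -> : M ^+ 2 * D = D ^+ 2 * (M ^+ 2 / D) by field.
  have -> : M ^+ 2 * s ^+ 2 = D ^+ 2 * (M ^+ 2 * s ^+ 2 / D ^+ 2) by field.
  by rewrite ler_pM2l.
by apply/eqP; rewrite -sqrf_eq0 eq_le M2 andbT; nra.
Qed.

(** Again 1 + z <= e^z, now below [h], gives r^2 (1 - r) <= u (1 - r^2) for all r > 0. Dividing by 1
    - r and letting r tend to 1 from below gives u >= 1/2, from above u <= 1/2. *)
Lemma normal_second_moment : E (fun x => x ^+ 2) = s ^+ 2.
Proof.
have i2 := normal_integrable_expr 2.
set v := E _.
pose u := v / (2 * s ^+ 2).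
have key r : 0 < r -> r ^+ 2 * (1 - r) <= u * (1 - r ^+ 2).
  move=> r0; have [ih Eh] := normal_expR_sqr r0.
  set h := fun x => _ in ih Eh.
  have : E (fun x => 1 + (- (r ^- 2 - 1) / (2 * s ^+ 2)) * x ^+ 2) <= r.
    rewrite -[leRHS]Eh; apply: le_expectation => // [|x].
      by apply: integrable_add; [exact: integrable_cst|exact: integrable_scale].
    apply: le_trans (expR_ge1Dx _); rewrite le_eqVlt; apply/orP; left; apply/eqP.
    by field; rewrite s_neq0 gt_eqF.
  rewrite RintegralD //; [|exact: integrable_cst|exact: integrable_scale].
  rewrite Rintegral_prob_cst RintegralZl // -/v => le1.
  have r2 : 0 < r ^+ 2 by rewrite exprn_gt0.
  have := ler_wpM2l (ltW r2) le1.
  have -> : r ^+ 2 * (1 + - (r ^- 2 - 1) / (2 * s ^+ 2) * v) = r ^+ 2 - u * (1 - r ^+ 2).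
    by rewrite /u; field; rewrite s_neq0 gt_eqF.
  by move: (u * _) => z; lra.
suff u2 : u = 2^-1.
  by rewrite -(mulfVK (_ : 2 * s ^+ 2 != 0) v) -/u ?u2 ?mulf_neq0 ?expf_neq0 //; field.
have u0 : 0 <= u.
  apply: divr_ge0; last by rewrite mulr_ge0 // sqr_ge0.
  by apply: Rintegral_ge0 => x _; exact: sqr_ge0.
clearbody u.
apply/eqP; rewrite eq_le; apply/andP; split; rewrite leNgt; apply/negP => hu.
  (* An explicit [e] replaces the limit: r = 1 + e violates [key] if u > 1/2, and r = 1 - e, with
     the next choice of [e], if u < 1/2. *)
  pose e := (2 * u - 1) / (4 * (1 + u)).
  have e0 : 0 < e by apply: divr_gt0; lra.
  have e1 : e * (4 * (1 + u)) = 2 * u - 1.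
    by rewrite /e divfK // gt_eqF //; lra.
  have := @key (1 + e); nra.
pose e := (1 - 2 * u) / 4.
have e0 : 0 < e by rewrite /e; lra.
have e1 : e <= 2^-1 by rewrite /e; lra.
have uE : u = (1 - 4 * e) / 2 by rewrite /e; field.
have e_lt1 : 0 < 1 - e by lra.
have := key _ e_lt1; rewrite uE -subr_ge0.
have -> : (1 - 4 * e) / 2 * (1 - (1 - e) ^+ 2) - (1 - e) ^+ 2 * (1 - (1 - e)) =
  e ^+ 2 * (e - 5 / 2) by field.
by rewrite pmulr_rge0 ?exprn_gt0 //; lra.
Qed.
End normal_moments.

(** * Gaussian matrices *)

Section same_law_matrices.
Context {R : realType} {n : nat} {d d' : measure_display} {T : measurableType d}
  {T' : measurableType d'} (P : probability T R) (P' : probability T' R).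
Variables (X : T -> 'M[R[i]]_n) (Y : T' -> 'M[R[i]]_n).
Hypotheses (mX : measurable_fun setT (X : T -> mxBorelType R n))
  (mY : measurable_fun setT (Y : T' -> mxBorelType R n))
  (XY : forall B, mxborel B -> P (X @^-1` B) = P' (Y @^-1` B)).

Lemma same_law_Emx (F : 'M[R[i]]_n -> 'M[R[i]]_n) : mxmeas (F : mxBorelType R n -> _) ->
  mx_integrable P' (fun w => F (Y w)) ->
  mx_integrable P (fun w => F (X w)) /\
  Emx P (fun w => F (X w)) = Emx P' (fun w => F (Y w)).
Proof.
move=> mF /mx_integrableP iY.
have H c := same_law_expectation mX mY XY (mF c) (iY c).
split; first by apply/mx_integrableP => c; exact: (H c).1.
apply/matrixP => i j.
have := (H (i, j, true)).2; have := (H (i, j, false)).2.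
rewrite /Rintegral /rcoord /= => e1 e2; rewrite !mxE unlock; congr Complex.
  exact: e2.
exact: e1.
Qed.
End same_law_matrices.

(** * Variables with moments of all orders *)

Section all_moments.
Context {R : realType} {d : measure_display} {T : measurableType d}
  (P : probability T R).
Local Notation Int f := (P.-integrable setT (EFin \o f)).

(** Finite moments of every order, rather than integrability, are stable under products; hence every
    polynomial in Gaussian variables is integrable. *)
Definition moments (f : T -> R) :=
  measurable_fun setT f /\ forall k, Int (fun w => `|f w| ^+ k).

Lemma moments_integrable f : moments f -> Int f.
Proof. by move=> [mf /(_ 1%N) i1]; apply: integrable_dom i1 _ => // w; rewrite expr1. Qed.

Lemma momentsD f g : moments f -> moments g -> moments (fun w => f w + g w).
Proof.
move=> [mf fi] [mg gi]; have mfg := measurable_funD mf mg; split=> // k.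
have := integrable_scale (2 ^+ k) (integrable_add (fi k) (gi k)).
move=> /integrable_dom; apply => [|w].
  by apply: expr_measurable; exact: measurableT_comp.
rewrite ger0_norm ?exprn_ge0 //; apply: le_trans (expr_sum_le _ _ _) => //.
by rewrite lerXn2r ?nnegrE ?addr_ge0 // ler_normD.
Qed.

Lemma momentsM f g : moments f -> moments g -> moments (fun w => f w * g w).
Proof.
move=> [mf fi] [mg gi]; have mfg := measurable_funM mf mg; split=> // k.
have := integrable_add (fi (k * 2)%N) (gi (k * 2)%N).
move=> /integrable_dom; apply => [|w].
  by apply: expr_measurable; exact: measurableT_comp.
rewrite ger0_norm ?exprn_ge0 // normrM exprMn !exprM.
have := exprn_ge0 k (normr_ge0 (f w)); have := exprn_ge0 k (normr_ge0 (g w)).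
by move: (_ ^+ k) (_ ^+ k) => x y x0 y0; nra.
Qed.

Lemma moments_cst a : moments (fun=> a).
Proof. by split=> [|k]; [exact: measurable_cst|exact: integrable_cst]. Qed.

Lemma moments_sum I (s : seq I) (f : I -> T -> R) :
  (forall i, moments (f i)) -> moments (fun w => \sum_(i <- s) f i w).
Proof.
move=> fi; elim: s => [|i s IH].
  by under eq_fun do rewrite big_nil; exact: moments_cst.
by under eq_fun do rewrite big_cons; exact: momentsD.
Qed.

Context {n : nat}.
Implicit Types X Y : T -> 'M[R[i]]_n.

Definition mxmoments X := forall c, moments (fun w => rcoord c (X w)).

Lemma mxmoments_integrable X : mxmoments X -> mx_integrable P X.
Proof. by move=> mX; apply/mx_integrableP => c; exact: moments_integrable. Qed.

Lemma mxmoments_cst A : mxmoments (fun=> A).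
Proof. by move=> c; exact: moments_cst. Qed.

Lemma mxmomentsM X Y : mxmoments X -> mxmoments Y -> mxmoments (fun w => X w *m Y w).
Proof.
move=> mX mY [[i j] b]; under eq_fun do rewrite rcoordM.
apply: moments_sum => k; apply: momentsD; first exact: (momentsM (mX _) (mY _)).
by apply: momentsM; [exact: moments_cst|exact: (momentsM (mX _) (mY _))].
Qed.

Lemma mxmoments_adj X : mxmoments X -> mxmoments (fun w => adjmx (X w)).
Proof.
move=> mX [[i j] b]; under eq_fun do rewrite rcoord_adj.
by apply: momentsM; [exact: moments_cst|exact: mX].
Qed.

Lemma mxmomentsX X k : mxmoments X -> mxmoments (fun w => X w ^+ k).
Proof.
move=> mX; elim: k => [|k IH].
  by under eq_fun do rewrite expr0; exact: mxmoments_cst.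
by under eq_fun do rewrite exprS -mulmxE; exact: mxmomentsM.
Qed.
End all_moments.

Section gaussian_matrices.
Context {R : realType} {d : measure_display} {T : measurableType d}
  (P : probability T R) {n N : nat} (V : 'I_N -> 'M[R[i]]_n)
  (g : 'I_N -> T -> R[i]).
Hypotheses (iidg : iid P (@cborel R) g) (gaussg : forall i, std_cgaussian P (g i)).
Hypothesis VV : \sum_i V i *m adjmx (V i) = 1%:M.
Local Notation Int f := (P.-integrable setT (EFin \o f)).
Local Notation E f := (Rintegral P setT f).

Definition part (b : bool) (z : R[i]) : R :=
  if b then complex.Re z else complex.Im z.

Let x i b w := part b (g i w).

Let cborel_part b (A : set R) : measurable A -> cborel (part b @^-1` A).
Proof. by move=> mA; apply: sub_sigma_algebra; exists A => //; case: b; [left|right]. Qed.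

Let measurable_x i b : measurable_fun setT (x i b).
Proof.
have [h _ _] := iidg => _ A mA; rewrite setTI.
exact: (h i _ (cborel_part b mA)).
Qed.

Let sigma : R := Num.sqrt 2^-1.
Let sigma_gt0 : 0 < sigma. Proof. by rewrite sqrtr_gt0 invr_gt0. Qed.

Let law_x i b (A : set R) : measurable A ->
  P (x i b @^-1` A) = normal_prob 0 sigma (id @^-1` A).
Proof.
move=> mA; have [_ h] := gaussg i.
have nT : normal_prob (0 : R) sigma setT = 1%E by exact: probability_setT.
case: b.
  have := h A setT mA measurableT; rewrite nT mule1 => <-; congr (P _).
  by apply/seteqP; split=> w //= [].
have := h setT A measurableT mA; rewrite nT mul1e => <-; congr (P _).
by apply/seteqP; split=> w //= [].
Qed.

Let expectation_x i b (f : R -> R) : measurable_fun setT f ->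
  (normal_prob 0 sigma).-integrable setT (EFin \o f) ->
  Int (fun w => f (x i b w)) /\
  E (fun w => f (x i b w)) = Rintegral (normal_prob 0 sigma) setT f.
Proof.
move=> mf fi.
pose Y : measurableTypeR R -> R := id.
have mY : measurable_fun setT Y by move=> ? A mA; rewrite setTI.
have := @same_law_expectation _ _ _ _ _ _ _ P (normal_prob 0 sigma) _ Y (measurable_x i b) mY (@law_x i b) f mf.
exact.
Qed.

Let moments_x i b : moments P (x i b).
Proof.
split=> // k.
have h l : Int (fun w => x i b w ^+ l).
  apply: (expectation_x i b _ (normal_integrable_expr sigma_gt0 l)).1.
  by apply: measurable_funX; exact: measurable_id.
have := integrable_add (integrable_cst P 1) (h (k * 2)%N).
move=> /integrable_dom; apply => [|w].
  by apply: expr_measurable; exact: measurableT_comp.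
rewrite ger0_norm ?exprn_ge0 // exprM -(real_normK (num_real (x i b w ^+ k))) normrX.
by move: (_ ^+ k) => z; nra.
Qed.

Let Ex i b : E (x i b) = 0.
Proof.
rewrite -(normal_mean sigma_gt0).
exact: (expectation_x i b (@measurable_id _ R setT) (normal_integrable_expr sigma_gt0 1)).2.
Qed.

Let Ex2 i b : E (fun w => x i b w * x i b w) = 2^-1.
Proof.
have mf : measurable_fun [set: R] (fun x => x ^+ 2).
  by apply: measurable_funX; exact: measurable_id.
have := (expectation_x i b mf (normal_integrable_expr sigma_gt0 2)).2.
by rewrite normal_second_moment // sqr_sqrtr ?invr_ge0.
Qed.

Let indep_x i j b b' : i != j -> indep_rv P (x i b) (x j b').
Proof.
move=> ij A B mA mB; have [_ h _] := iidg.
pose S k : set R[i] := if k == i then part b @^-1` A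
  else if k == j then part b' @^-1` B else setT.
have mS k : cborel (S k).
  rewrite /S; case: ifP => _; first exact: cborel_part.
  case: ifP => _; first exact: cborel_part.
  by rewrite -(preimage_setT (part true)); apply: cborel_part.
have ji : (j == i) = false by rewrite eq_sym; exact/negbTE.
have Si : g i @^-1` S i = x i b @^-1` A by rewrite /S eqxx.
have Sj : g j @^-1` S j = x j b' @^-1` B by rewrite /S ji eqxx.
rewrite -Si -Sj.
have -> : g i @^-1` S i `&` g j @^-1` S j = \bigcap_(k in [set: 'I_N]) (g k @^-1` S k).
  apply/seteqP; split=> [w [wi wj] k _ /=|w h']; last by split; exact: h'.
  have [->//|ki] := eqVneq k i; have [->//|kj] := eqVneq k j.
  by rewrite /S (negbTE ki) (negbTE kj).
rewrite (h S mS) (bigD1 i) //= (bigD1 j) ?ji //= big1 ?mule1 // => k /andP[ki kj].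
by rewrite /S (negbTE ki) (negbTE kj) preimage_setT probability_setT.
Qed.

Let Exx i j b b' : i != j -> E (fun w => x i b w * x j b' w) = 0.
Proof.
move=> ij.
have [_ ->] := indep_rvM (measurable_x i b) (measurable_x j b') (indep_x b b' ij)
  (moments_integrable (moments_x i b)) (moments_integrable (moments_x j b')).
by rewrite Ex mul0r.
Qed.

Let X w := \sum_i g i w *: V i.

(** The sign is -1 for the real part of the product and +1 for the imaginary part. *)
Let rcoordZ c z (A : 'M[R[i]]_n) : rcoord c (z *: A) = part true z * rcoord c A
   + (- (-1) ^+ ~~ c.2) * (part false z * rcoord (c.1, ~~ c.2) A).
Proof.
case: c => [[a e] b]; rewrite /rcoord /part mxE; case: z (A a e) => p q [r t].
by case: b => /=; rewrite ?expr0 ?expr1 ?opprK ?mul1r ?mulN1r.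
Qed.

Let rcoord_sum c (F : 'I_N -> 'M[R[i]]_n) : rcoord c (\sum_i F i) = \sum_i rcoord c (F i).
Proof.
by apply: (big_morph (rcoord c)) => [A B|]; [exact: rcoordD|exact: rcoord0].
Qed.

Let rcoord_inj (A B : 'M[R[i]]_n) : (forall c, rcoord c A = rcoord c B) -> A = B.
Proof.
move=> h; apply/matrixP => i j; have := h (i, j, true); have := h (i, j, false).
by rewrite /rcoord /=; case: (A i j) (B i j) => p q [r t] /= -> ->.
Qed.

Lemma gaussian_mxmoments : mxmoments P X.
Proof.
move=> c; rewrite /X; under eq_fun do rewrite rcoord_sum.
apply: moments_sum => i; under eq_fun do rewrite rcoordZ; apply: momentsD.
  by apply: momentsM => //; [exact: (moments_x i true)|exact: moments_cst].
apply: momentsM; first exact: moments_cst.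
by apply: momentsM => //; [exact: (moments_x i false)|exact: moments_cst].
Qed.

Let expectation_rcoordZ c (z : T -> R[i]) (A : 'M[R[i]]_n) (r t : R) :
  Int (fun w => part true (z w)) -> Int (fun w => part false (z w)) ->
  E (fun w => part true (z w)) = r -> E (fun w => part false (z w)) = t ->
  Int (fun w => rcoord c (z w *: A)) /\
  E (fun w => rcoord c (z w *: A)) =
    r * rcoord c A + (- (-1) ^+ ~~ c.2) * (t * rcoord (c.1, ~~ c.2) A).
Proof.
move=> i1 i2 <- <-.
have j1 : Int (fun w => part true (z w) * rcoord c A).
  by under eq_fun do rewrite mulrC; exact: integrable_scale.
have j2 : Int (fun w => part false (z w) * rcoord (c.1, ~~ c.2) A).
  by under eq_fun do rewrite mulrC; exact: integrable_scale.
have j3 := integrable_scale (- (-1) ^+ ~~ c.2) j2.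
under eq_fun do rewrite rcoordZ; split; first exact: integrable_add.
by rewrite RintegralD // RintegralZl // !RintegralZr.
Qed.

Lemma gaussian_mean : Emx P X = 0.
Proof.
apply: rcoord_inj => c; rewrite rcoord_Emx rcoord0 /X.
have ix i b := moments_integrable (moments_x i b).
have H i := expectation_rcoordZ c (V i) (ix i true) (ix i false) (Ex i true) (Ex i false).
under eq_Rintegral do rewrite rcoord_sum.
rewrite Rintegral_bigsum; last by move=> i; exact: (H i).1.
by apply: big1 => i _; rewrite (H i).2 !mul0r mulr0 addr0.
Qed.

Let conj_part i j w b : part b (g i w * Num.conj (g j w)) =
  if b then x i true w * x j true w + x i false w * x j false w
  else x i false w * x j true w + (-1) * (x i true w * x j false w).
Proof.
rewrite /x /part; case: (g i w) (g j w) => p q [r t]; case: b => /=; ring.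
Qed.

(** For [i = j] the real part has mean 1/2 + 1/2 and the imaginary part cancels pointwise. For
    distinct indices every product has mean 0 by independence. *)
Let expectation_conj i j b :
  Int (fun w => part b (g i w * Num.conj (g j w))) /\
  E (fun w => part b (g i w * Num.conj (g j w))) = (b && (i == j))%:R.
Proof.
have ixx a a' := moments_integrable (momentsM (moments_x i a) (moments_x j a')).
have -> : (fun w => part b (g i w * Num.conj (g j w))) =
  (fun w => if b then x i true w * x j true w + x i false w * x j false w
  else x i false w * x j true w + (-1) * (x i true w * x j false w)).
  by apply/funext => w; exact: conj_part.
have izz := integrable_scale (-1) (ixx true false).
case: b; split.
- exact: (integrable_add (ixx true true) (ixx false false)).
- rewrite RintegralD //; have [<-|ij] := eqVneq i j; last by rewrite !Exx // addr0.
  by rewrite !Ex2 /=; field.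
- exact: (integrable_add (ixx false true) izz).
- rewrite RintegralD // RintegralZl //; have [<-|ij] := eqVneq i j.
    under eq_Rintegral do rewrite mulrC.
    by rewrite mulN1r subrr.
  by rewrite !Exx // mulr0 addr0.
Qed.

(** In the double sum over [i] and [j] the orthonormality of the [g i] leaves the diagonal, which is
    the sum in [VV]. *)
Lemma gaussian_gram : Emx P (fun w => X w *m adjmx (X w)) = 1%:M.
Proof.
have XX w : X w *m adjmx (X w) =
    \sum_i \sum_j (g i w * Num.conj (g j w)) *: (V i *m adjmx (V j)).
  rewrite /X mulmx_suml; apply: eq_bigr => i _.
  have -> : adjmx (\sum_j g j w *: V j) = \sum_j Num.conj (g j w) *: adjmx (V j).
    rewrite /adjmx raddf_sum /= raddf_sum; apply: eq_bigr => j _.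
    by rewrite linearZ /= map_mxZ.
  rewrite mulmx_sumr; apply: eq_bigr => j _.
  by rewrite -scalemxAl -scalemxAr scalerA.
apply: rcoord_inj => c; rewrite rcoord_Emx -VV rcoord_sum.
have H i j := expectation_rcoordZ c (V i *m adjmx (V j)) (expectation_conj i j true).1
  (expectation_conj i j false).1 (expectation_conj i j true).2 (expectation_conj i j false).2.
under eq_Rintegral => w _.
  rewrite XX rcoord_sum; under eq_bigr do rewrite rcoord_sum.
  over.
rewrite Rintegral_bigsum; last first.
  by move=> i; apply: integrable_bigsum => j; exact: (H i j).1.
apply: eq_bigr => i _; rewrite Rintegral_bigsum; last by move=> j; exact: (H i j).1.
rewrite (bigD1 i) //= big1 ?addr0 => [|j ji]; rewrite (H _ _).2 /= ?eqxx.
  by rewrite mul1r mul0r mulr0 addr0.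
by rewrite eq_sym (negbTE ji) !mul0r mulr0 addr0.
Qed.
End gaussian_matrices.

(** Two reductions to generators: preimages of sets of matrices reduce to single entries, and those
    of sets of complex numbers to real and imaginary parts. *)
Lemma mxmeas_measurable (R : realType) (n : nat) (d : measure_display)
    (T : measurableType d) (X : T -> 'M[R[i]]_n) :
  mxmeas X -> measurable_fun setT (X : T -> mxBorelType R n).
Proof.
move=> mX; apply: (@measurability _ _ T (mxBorelType R n) setT X (@mxgen R n) erefl).
move=> _ [_ [i [j [B cB ->]]] <-].
pose f w := X w i j; rewrite setTI -[X in measurable X]/(f @^-1` B).
have saT := sigma_algebra_measurable T.
rewrite -[X in measurable X]setTI; apply: (smallest_sub (sigma_algebra_image f saT)) cB.
move=> _ [A mA [] ->]; rewrite /image_set_system /=.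
  exact: (mX (i, j, true) measurableT A mA).
exact: (mX (i, j, false) measurableT A mA).
Qed.

(** * From Frobenius norms back to traces *)

Section conclusion.
Context {R : realType} {n m : nat} {dsp : measure_display} {T : measurableType dsp}
  (P : probability T R) (G : 'I_m -> T -> 'M[R[i]]_n).
Local Notation gram i := (fun w => G i w *m adjmx (G i w)).

(** The hypotheses speak of one variable and reach the others through equality of laws. Both
    extended expectations are shown finite, so the real inequality for Frobenius norms can be read
    for them. *)
Lemma Etr_abs_hypercontractive (k d : nat) (Q : {set 'I_m} -> 'M[R[i]]_n) (c : R)
    (o : 'I_m) :
  let QG w := ncpoly_eval d Q (fun j => G j w) in
  iid P (@mxborel R n) G -> 1 <= c ->
  opnorm (Emx P (fun w => gram o w ^+ k.+1)) <= c ->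
  mx_integrable P (G o) -> Emx P (G o) = 0 ->
  mx_integrable P (gram o) -> Emx P (gram o) = 1%:M ->
  mx_integrable P (fun w => gram o w ^+ k.+1) ->
  (Etr_abs P (2 * k.+1) QG <=
     ((2 * k.+1%:R - 1) ^+ (d * k.+1) * c ^+ d)%:E * Etr_abs P 2 QG ^+ k.+1)%E.
Proof.
move=> QG iidG c1 EK iG1 EG1 iGG1 EGG1 iGK1.
have [_ _ eqlaw] := iidG.
have law i := same_law_Emx (measurable_G iidG i) (measurable_G iidG o) (eqlaw i o).
have m1 : mxmeas (id : mxBorelType R n -> _) := mxmeas_id.
have m2 : mxmeas ((fun A => A *m adjmx A) : mxBorelType R n -> 'M[R[i]]_n).
  by apply: mxmeasM => //; exact: mxmeas_adj.
have m3 := mxmeasX k.+1 m2.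
have iG i : mx_integrable P (G i) := (law i _ m1 iG1).1.
have EG i : Emx P (G i) = 0 by have := (law i _ m1 iG1).2; rewrite EG1.
have iGG i : mx_integrable P (gram i) := (law i _ m2 iGG1).1.
have EGG i : Emx P (gram i) = 1%:M by have := (law i _ m2 iGG1).2; rewrite EGG1.
have iGK i : mx_integrable P (fun w => gram i w ^+ k.+1) := (law i _ m3 iGK1).1.
have EGK i : opnorm (Emx P (fun w => gram i w ^+ k.+1)) <= c.
  by have := (law i _ m3 iGK1).2 => ->.
have [g g0 gc] := root_exists k (le_trans ler01 c1).
have g1 : 1 <= g by rewrite -(@expr_ge1 _ k.+1) // gc.
have [mQ iQ EQ] := fro2_hypercontractive iidG g1 gc iG EG iGG EGG iGK EGK d Q.
have mF := measurable_fro2 mQ.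
have iQ1 : P.-integrable setT (EFin \o (fun w => fro2 (QG w))).
  by apply: integrable_expr iQ => // w; exact: fro2_ge0.
have -> : Etr_abs P 2 QG = (Rintegral P setT (fun w => fro2 (QG w)))%:E.
  rewrite /Etr_abs unlock fineK; last exact: integrable_fin_num.
  apply: eq_integral => w _.
  by rewrite -[2%N]/(2 * 1)%N absmx_expr expr1 -dot_trE dotXX.
pose h w := complex.Re (\tr ((QG w *m adjmx (QG w)) ^+ k.+1)).
have mh : measurable_fun setT h.
  have -> : h = fun w => \sum_i rcoord (i, i, true) ((QG w *m adjmx (QG w)) ^+ k.+1).
    by apply/funext => w; rewrite /h /mxtrace raddf_sum.
  apply: measurable_sum => i; apply: mxmeasX; apply: mxmeasM => //.
  exact: mxmeas_adj.
have ih : P.-integrable setT (EFin \o h).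
  by apply: integrable_dom iQ _ => // w; exact: tr_gram_expr_le.
have -> : Etr_abs P (2 * k.+1) QG = (Rintegral P setT h)%:E.
  rewrite /Etr_abs unlock fineK; last exact: integrable_fin_num.
  by apply: eq_integral => w _; rewrite absmx_expr.
rewrite -EFin_expe -EFinM lee_fin.
apply: le_trans (le_expectation ih iQ _) _.
  by move=> w; apply: le_trans (ler_norm _) _; exact: tr_gram_expr_le.
(* With [g ^+ k.+1 = c], the power of [g] in the bound is exactly [c ^+ d]. *)
apply: le_trans EQ _; rewrite exprMn -exprM exprMn [g ^+ _](_ : _ = c ^+ d) //.
by rewrite mulnC exprM gc.
Qed.
End conclusion.

Theorem theorem3p1 (R : realType) (K m n d : nat)
    (K_gt0 : (0 < K)%N) (m_gt0 : (0 < m)%N) (n_gt0 : (0 < n)%N)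
    (d_gt0 : (0 < d)%N) (Q : {set 'I_m} -> 'M[R[i]]_n)
    (dsp : measure_display) (T : measurableType dsp) (P : probability T R)
    (G : 'I_m -> T -> 'M[R[i]]_n) (c : R) :
  let G1 := G (Ordinal m_gt0) in
  let QG := fun w => ncpoly_eval d Q (fun j => G j w) in
  iid P (@mxborel R n) G ->
  1 <= c ->
  opnorm (Emx P (fun w => (G1 w *m adjmx (G1 w)) ^+ K)) <= c ->
  (forall (N : nat) (V : 'I_N -> 'M[R[i]]_n),
     \sum_i V i *m adjmx (V i) = 1%:M ->
     \sum_i adjmx (V i) *m V i = 1%:M ->
     gaussian_mx_law P V G1 ->
     (Etr_abs P (2 * K) QG <=
        ((2 * K%:R - 1) ^+ (d * K) * c ^+ d)%:E * Etr_abs P 2 QG ^+ K)%E)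
  /\
  (mx_integrable P G1 -> Emx P G1 = 0 ->
   mx_integrable P (fun w => G1 w *m adjmx (G1 w)) ->
   Emx P (fun w => G1 w *m adjmx (G1 w)) = 1%:M ->
   mx_integrable P (fun w => (G1 w *m adjmx (G1 w)) ^+ K) ->
     (Etr_abs P (2 * K) QG <=
        ((2 * K%:R - 1) ^+ (2 * d * K) * c ^+ d)%:E * Etr_abs P 2 QG ^+ K)%E).
Proof.
case: K K_gt0 => // k _ /= iidG c1 EK; split.
  (* The moment conditions are verified on the explicit Gaussian sum [X] and carried to the first
     variable by equality of laws. *)
  move=> N V VV _ [dsp' [T' [P' [g [iidg gaussg law]]]]].
  pose X w := \sum_i g i w *: V i.
  have momX : mxmoments P' X by exact: gaussian_mxmoments.
  have mX : measurable_fun setT (X : T' -> mxBorelType R n).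
    by apply: mxmeas_measurable => e; exact: (momX e).1.
  have tr := same_law_Emx (measurable_G iidG (Ordinal m_gt0)) mX law.
  have m1 : mxmeas (id : mxBorelType R n -> _) := mxmeas_id.
  have m2 : mxmeas ((fun A => A *m adjmx A) : mxBorelType R n -> 'M[R[i]]_n).
    by apply: mxmeasM => //; exact: mxmeas_adj.
  have momXX : mxmoments P' (fun w => X w *m adjmx (X w)).
    by apply: mxmomentsM => //; exact: mxmoments_adj.
  have [i1 E1] := tr _ m1 (mxmoments_integrable momX).
  have [i2 E2] := tr _ m2 (mxmoments_integrable momXX).
  have [i3 _] := tr _ (mxmeasX k.+1 m2) (mxmoments_integrable (mxmomentsX k.+1 momXX)).
  apply: (Etr_abs_hypercontractive d Q iidG c1 EK i1 _ i2 _ i3).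
    by rewrite E1; exact: gaussian_mean.
  by rewrite E2; exact: gaussian_gram.
move=> i1 E1 i2 E2 i3.
(* Since 2K - 1 >= 1, doubling the exponent only enlarges the bound; the factor it multiplies is
   nonnegative. *)
apply: le_trans (Etr_abs_hypercontractive d Q iidG c1 EK i1 E1 i2 E2 i3) _.
have k0 : 0 <= k%:R :> R by [].
apply: lee_wpmul2r.
  apply: expe_ge0; rewrite /Etr_abs unlock; apply: integral_ge0 => w _.
  by rewrite lee_fin -[2%N]/(2 * 1)%N absmx_expr expr1 -dot_trE dotXX fro2_ge0.
rewrite lee_fin ler_wpM2r ?exprn_ge0 ?(le_trans ler01 c1) //.
rewrite ler_weXn2l // -?mulnA ?leq_pmull //.
by rewrite -natr1; lra.
Qed.
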